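(* Let $(\Pi_{\sigma,\tau})_{0\le\sigma\le\tau}$ be a No Free Lunch TCPP that is strongly admissible with respect to the reference family $((S^k)_{0\le k\le d},(Y^l)_{1\le l\le p})$ and the observed bid and ask prices $(C^l_{bid},C^l_{ask})_{1\le l\le p}$. Let $\mathcal M^e$ be the set of equivalent local martingale measures for the process $(S^k)_{0\le k\le d}$ and, for $Q\in\mathcal M^e$, let $$\beta(Q)=\sup\Big(0,\ \sup_{1\le l\le p}\big(C^l_{bid}-E_Q(Y^l),\ E_Q(Y^l)-C^l_{ask}\big)\Big).$$ Then for any $X\in L^\infty(\mathcal F_\infty)$, $$\inf_{Q\in\mathcal M^e}(E_Q(X)+\beta(Q))\le-\Pi_{0,\infty}(-X)\le\Pi_{0,\infty}(X)\le\sup_{Q\in\mathcal M^e}(E_Q(X)-\beta(Q)).$$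
   Context: Setting. $(\Omega,\mathcal F_\infty,(\mathcal F_t)_{t\in\mathbb R_+},P)$ is a filtered probability space; the filtration is right continuous and complete, and $\mathcal F_0$ is the $\sigma$-algebra generated by the $P$-null sets of $\mathcal F_\infty$. Stopping times take values in $[0,+\infty]$, and $\mathcal F_\tau=\{A\in\mathcal F_\infty : A\cap\{\tau\le t\}\in\mathcal F_t\ \forall t\in\mathbb R_+\}$. $L^\infty(\mathcal F_\tau)=L^\infty(\Omega,\mathcal F_\tau,P)$ (real valued classes); (in)equalities between elements hold $P$-a.s. A dynamic pricing procedure is a family of maps $\Pi_{\sigma,\tau}:L^\infty(\mathcal F_\tau)\to L^\infty(\mathcal F_\sigma)$, indexed by stopping times $0\le\sigma\le\tau$, such that for all $X,Y\in L^\infty(\mathcal F_\tau)$: monotonicity: $X\le Y\Rightarrow\Pi_{\sigma,\tau}(X)\le\Pi_{\sigma,\tau}(Y)$; translation invariance: $\Pi_{\sigma,\tau}(X+Z)=\Pi_{\sigma,\tau}(X)+Z$ for all $Z\in L^\infty(\mathcal F_\sigma)$; convexity: $\Pi_{\sigma,\tau}(\lambda X+(1-\lambda)Y)\le\lambda\Pi_{\sigma,\tau}(X)+(1-\lambda)\Pi_{\sigma,\tau}(Y)$ for all $\lambda\in[0,1]$; normalization: $\Pi_{\sigma,\tau}(0)=0$. It is time-consistent if $\Pi_{\nu,\sigma}(\Pi_{\sigma,\tau}(X))=\Pi_{\nu,\tau}(X)$ for all stopping times $0\le\nu\le\sigma\le\tau$ and $X\in L^\infty(\mathcal F_\tau)$.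 It is continuous from below if for every increasing sequence $X_n$ in $L^\infty(\mathcal F_\tau)$ with limit $X\in L^\infty(\mathcal F_\tau)$, the increasing sequence $\Pi_{\sigma,\tau}(X_n)$ has limit $\Pi_{\sigma,\tau}(X)$. A TCPP is a time-consistent dynamic pricing procedure that is continuous from below. No Free Lunch. Let $\mathcal C=\{\lambda X : \lambda\in\mathbb R_+,\ X\in L^\infty(\Omega,\mathcal F_\infty,P),\ \Pi_{0,\infty}(X)\le0\}$ and let $\overline{\mathcal C}$ be its closure in $L^\infty(\Omega,\mathcal F_\infty,P)$ for the weak* topology $\sigma(L^\infty(P),L^1(P))$. A TCPP has No Free Lunch if $\overline{\mathcal C}\cap L^\infty_+(\Omega,\mathcal F_\infty,P)=\{0\}$. Market model. $(S^k)_{0\le k\le d}$ is an $\mathbb R^{d+1}$-valued adapted process with $S^0\equiv1$ (numéraire), and $(S^k)_{1\le k\le d}$ locally bounded: there are stopping times $\tau_n$ increasing to $\infty$ such that each stopped process $S^k_{t\wedge\tau_n}$ is uniformly bounded. A TCPP extends the dynamics of $(S^k)_{0\le k\le d}$ if for all $0\le k\le d$, all $n\in\mathbb Z$ and all stopping times $0\le\sigma\le\tau$ such that $S^k_\tau\in L^\infty(\mathcal F_\tau)$, $\Pi_{\sigma,\tau}(nS^k_\tau)=nS^k_\sigma$. A probability measure $R\ll P$ is a local martingale measure with respect to $(S^k)_{0\le k\le d}$ if for all $0\le k\le d$, all stopping times $\tau$ such that $S^k_\tau\in L^\infty(\mathcal F_\tau)$ and all stopping times $\sigma\le\tau$, $E_R(S^k_\tau|\mathcal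 F_\sigma)=S^k_\sigma$ $R$-a.s.; it is an equivalent local martingale measure if moreover $R\sim P$. Options and strong admissibility. For $1\le l\le p$, $\tau_l$ is a stopping time, $Y^l\in L^\infty(\mathcal F_{\tau_l})$, and $C^l_{bid},C^l_{ask}$ are real numbers (bid and ask prices of $Y^l$ observed at time $0$). A dynamic pricing procedure is strongly admissible with respect to $((S^k)_{0\le k\le d},(Y^l)_{1\le l\le p})$ and $(C^l_{bid},C^l_{ask})_{1\le l\le p}$ if it extends the dynamics of $(S^k)_{0\le k\le d}$ and $C^l_{bid}\le-\Pi_{0,\tau_l}(-Y^l)\le\Pi_{0,\tau_l}(Y^l)\le C^l_{ask}$ for all $1\le l\le p$. *)

(* Defs.v *)
From HB Require Import structures.
From mathcomp Require Import all_boot all_order all_algebra.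
From mathcomp Require Import all_classical all_reals all_analysis.

Set Implicit Arguments.
Unset Strict Implicit.
Unset Printing Implicit Defensive.

Import Order.TTheory GRing.Theory Num.Theory.
Import numFieldTopology.Exports numFieldNormedType.Exports.

Local Open Scope classical_set_scope.
Local Open Scope ring_scope.

(* The sigma-algebra F_oo is the ambient one, [disp.-measurable]; the time set
   is the half line [0 <= t] of R, and families indexed by R are only
   constrained there. *)
Section Filtration.
Context (R : realType) (disp : measure_display) (T : measurableType disp).
Variables (P : probability T R) (F : R -> set_system T).

Definition filtration :=
  (forall t, 0 <= t ->
     sigma_algebra [set: T] (F t) /\ F t `<=` disp.-measurable) /\
  (forall s t, 0 <= s -> s <= t -> F s `<=` F t).

Definition usual_conditions :=
  [/\ measure_is_complete P,
      (forall t, 0 <= t -> F t = \bigcap_(s in [set s | t < s]) F s) &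
      F 0 = <<s [set A | measurable A /\ P A = 0%E] >>].

Definition stopping_time (tau : T -> \bar R) :=
  (forall w, (0 <= tau w)%E) /\
  (forall t, 0 <= t -> F t [set w | (tau w <= t%:E)%E]).

Definition stopped_sigma (tau : T -> \bar R) : set_system T :=
  [set A | measurable A /\
    forall t, 0 <= t -> F t (A `&` [set w | (tau w <= t%:E)%E])].

Definition le_time (sigma tau : T -> \bar R) := forall w, (sigma w <= tau w)%E.

Definition time0 : T -> \bar R := cst 0%E.
Definition time_oo : T -> \bar R := cst +oo%E.

End Filtration.
Arguments time0 {R disp T}.
Arguments time_oo {R disp T}.

Section PricingProcedure.
Context (R : realType) (disp : measure_display) (T : measurableType disp).
Variables (P : probability T R).

Definition measurable_wrt (G : set_system T) (X : T -> R) :=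
  preimage_set_system [set: T] X measurable `<=` G.

(* The elements of L^oo(G) are handled through their representatives, and
   compared P-almost surely. *)
Definition Linfty (G : set_system T) : set (T -> R) :=
  [set X | X \in Lfun P +oo%E /\ measurable_wrt G X].

Variable F : R -> set_system T.

Definition LF (tau : T -> \bar R) := Linfty (stopped_sigma F tau).

(* [Pi sigma tau X] is only meaningful when sigma <= tau are stopping times and
   X is in L^oo(F_tau). *)
Definition pricing_family :=
  (T -> \bar R) -> (T -> \bar R) -> (T -> R) -> (T -> R).

Variable Pi : pricing_family.

(* Monotonicity makes each map compatible with P-a.s. equality, that is, a map
   between spaces of classes. *)
Definition dynamic_pricing_procedure :=
  forall sigma tau, stopping_time F sigma -> stopping_time F tau ->
    le_time sigma tau ->
  [/\ (forall X, LF tau X -> LF sigma (Pi sigma tau X)),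
      (forall X Y, LF tau X -> LF tau Y ->
         (\forall w \ae P, X w <= Y w) ->
         \forall w \ae P, Pi sigma tau X w <= Pi sigma tau Y w),
      (forall X Z, LF tau X -> LF sigma Z ->
         \forall w \ae P, Pi sigma tau (X \+ Z) w = Pi sigma tau X w + Z w),
      (forall X Y (l : R), LF tau X -> LF tau Y -> 0 <= l <= 1 ->
         \forall w \ae P,
           Pi sigma tau (fun v => l * X v + (1 - l) * Y v) w
             <= l * Pi sigma tau X w + (1 - l) * Pi sigma tau Y w) &
      (\forall w \ae P, Pi sigma tau (cst 0) w = 0)].

Definition time_consistent :=
  forall nu sigma tau, stopping_time F nu -> stopping_time F sigma ->
    stopping_time F tau -> le_time nu sigma -> le_time sigma tau ->
  forall X, LF tau X ->
    \forall w \ae P, Pi nu sigma (Pi sigma tau X) w = Pi nu tau X w.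

Definition continuous_from_below :=
  forall sigma tau, stopping_time F sigma -> stopping_time F tau ->
    le_time sigma tau ->
  forall (Xn : nat -> T -> R) (X : T -> R),
    (forall n, LF tau (Xn n)) -> LF tau X ->
    (forall n, \forall w \ae P, Xn n w <= Xn n.+1 w) ->
    (\forall w \ae P, Xn n w @[n --> \oo] --> X w) ->
  \forall w \ae P, Pi sigma tau (Xn n) w @[n --> \oo] --> Pi sigma tau X w.

Definition TCPP :=
  [/\ dynamic_pricing_procedure, time_consistent & continuous_from_below].

End PricingProcedure.

Section NoFreeLunch.
Context (R : realType) (disp : measure_display) (T : measurableType disp).
Variables (P : probability T R).

Definition L1fun := LfunType P (lexx 1%E).
Definition Loofun := LfunType P (leey 1%E).

Definition L1_pairing (X : Loofun) : {ptws L1fun -> R} :=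
  fun g : L1fun => \int[P]_w (X w * g w).

(* sigma(L^oo, L^1), pulled back from classes to representatives: it is the
   coarsest topology for which every X |-> E_P[X g], with g in L^1, is
   continuous. *)
Definition weakstar := initial_topology L1_pairing.

Variables (F : R -> set_system T) (Pi : pricing_family R T).

Definition free_lunch_cone : set weakstar :=
  [set Y | exists (l : R) (X : Loofun),
    [/\ 0 <= l, \forall w \ae P, Pi time0 time_oo X w <= 0 &
        Y = l *: X]].

Definition no_free_lunch :=
  closure free_lunch_cone `&`
    [set X : weakstar | \forall w \ae P, 0 <= (X : Loofun) w] =
  [set X : weakstar | \forall w \ae P, (X : Loofun) w = 0].

End NoFreeLunch.

Section Market.
Context (R : realType) (disp : measure_display) (T : measurableType disp).
Variables (P : probability T R) (F : R -> set_system T).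

Definition adapted (S : R -> T -> R) :=
  forall t, 0 <= t -> measurable_wrt (F t) (S t).

(* S_tau, with the usual convention that S_oo is the limit of S_t as t tends to
   infinity. *)
Definition at_time (S : R -> T -> R) (tau : T -> \bar R) (w : T) : R :=
  match tau w with
  | t%:E => S t w
  | _ => lim (S t w @[t --> +oo])
  end.

(* [lim] is total, so the a.s. existence of S_tau has to be required. *)
Definition at_time_Linfty (S : R -> T -> R) (tau : T -> \bar R) :=
  (\forall w \ae P, tau w = +oo%E -> cvg (S t w @[t --> +oo])) /\
  LF P F tau (at_time S tau).

(* The index [ord0] is the numeraire, the indices [lift ord0 k] are the d other
   assets. *)
Definition locally_bounded (d : nat) (S : 'I_d.+1 -> R -> T -> R) :=
  exists tau : nat -> T -> \bar R,
  [/\ (forall n, stopping_time F (tau n)),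
      (forall n, \forall w \ae P, (tau n w <= tau n.+1 w)%E),
      (\forall w \ae P, tau n w @[n --> \oo] --> +oo%E) &
      forall n (k : 'I_d), exists M : R, \forall w \ae P, forall t : R, 0 <= t ->
        `|S (lift ord0 k) (fine (mine t%:E (tau n w))) w| <= M].

Definition market_model (d : nat) (S : 'I_d.+1 -> R -> T -> R) :=
  [/\ (forall k, adapted (S k)),
      (forall t w, 0 <= t -> S ord0 t w = 1) &
      locally_bounded S].

Definition extends_dynamics (Pi : pricing_family R T)
    (d : nat) (S : 'I_d.+1 -> R -> T -> R) :=
  forall (k : 'I_d.+1) (n : int) sigma tau,
    stopping_time F sigma -> stopping_time F tau -> le_time sigma tau ->
    at_time_Linfty (S k) tau ->
  \forall w \ae P,
    Pi sigma tau (fun v => n%:~R * at_time (S k) tau v) w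
      = n%:~R * at_time (S k) sigma w.

(* E_Q[X | G] = Y Q-a.s. *)
Definition cond_expectation_eq (Q : probability T R) (G : set_system T)
    (X Y : T -> R) :=
  exists Z : T -> R,
  [/\ measurable_wrt G Z, Q.-integrable [set: T] (EFin \o Z),
      (forall A, G A ->
         (\int[Q]_(w in A) (Z w)%:E = \int[Q]_(w in A) (X w)%:E)%E) &
      \forall w \ae Q, Z w = Y w].

Definition local_martingale_measure (d : nat) (S : 'I_d.+1 -> R -> T -> R)
    (Q : probability T R) :=
  Q `<< P /\
  forall (k : 'I_d.+1) sigma tau,
    stopping_time F sigma -> stopping_time F tau -> le_time sigma tau ->
    at_time_Linfty (S k) tau ->
  cond_expectation_eq Q (stopped_sigma F sigma)
    (at_time (S k) tau) (at_time (S k) sigma).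

Definition equiv_local_martingale_measures (d : nat)
    (S : 'I_d.+1 -> R -> T -> R) : set (probability T R) :=
  [set Q | local_martingale_measure S Q /\ P `<< Q].

Definition strongly_admissible (Pi : pricing_family R T)
    (d : nat) (S : 'I_d.+1 -> R -> T -> R)
    (p : nat) (tau : 'I_p -> T -> \bar R) (Y : 'I_p -> T -> R)
    (Cbid Cask : 'I_p -> R) :=
  extends_dynamics Pi S /\
  forall l : 'I_p, \forall w \ae P,
    [/\ Cbid l <= - Pi time0 (tau l) (\- Y l) w,
        - Pi time0 (tau l) (\- Y l) w <= Pi time0 (tau l) (Y l) w &
        Pi time0 (tau l) (Y l) w <= Cask l].

Definition beta (p : nat) (Y : 'I_p -> T -> R) (Cbid Cask : 'I_p -> R)
    (Q : probability T R) : \bar R :=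
  (\big[maxe/0]_(l < p)
     maxe ((Cbid l)%:E - 'E_Q[Y l]) ('E_Q[Y l] - (Cask l)%:E))%E.

End Market.

(* Main.v *)
From HB Require Import structures.
Require Import Defs.
From mathcomp Require Import all_boot all_order all_algebra.
From mathcomp Require Import all_classical all_reals all_analysis.
From mathcomp Require Import measurable_realfun ess_sup_inf ring lra.

Set Implicit Arguments.
Unset Strict Implicit.
Unset Printing Implicit Defensive.

Import Order.TTheory GRing.Theory Num.Theory.
Import numFieldTopology.Exports numFieldNormedType.Exports.

Local Open Scope classical_set_scope.
Local Open Scope ring_scope.

(** Since the sigma-algebra at time 0 is trivial, the price at time 0 of a
    payoff at infinity is almost surely a constant [price X], and [price] is a
    convex, monotone, translation invariant functional on [L^oo] that is
    continuous from below ([monetary_price]). It has the dual representation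

      price X = sup over Q << P of (E_Q X - penalty of Q),

    where the penalty of [Q] is the supremum of [E_Q Z - price Z]. The upper
    bound follows from this formula and two remarks.

    - A probability [Q] of finite penalty [a] prices the market consistently.
      For an event [A] of [F sigma], the position [n \1_A (S_tau - S_sigma)] has
      price at most [0] for every integer [n] of either sign, because the
      procedure extends the dynamics of [S]; hence [n E_Q (\1_A (S_tau - S_sigma))]
      is at most [a] for all [n], and this expectation vanishes. So [Q] is a local
      martingale measure ([penalty_local_martingale]). Applied to [Y l] and
      [- Y l], the definition of the penalty gives [beta Q <= a]
      ([beta_le_penalty]).
    - [Q] can be taken equivalent to [P]. By No Free Lunch, every nonnegligible
      event has a positive price, so it is charged by some [Q] of penalty at most
      [1]; the Halmos-Savage exhaustion argument then produces an equivalent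
      probability of penalty at most [1] ([exists_equivalent_penalty_le1]), and a
      little of it is mixed into a nearly optimal [Q]
      ([monetary_dual_equivalent]).

    The lower bound is the upper bound for [- X], and the middle inequality is
    convexity.

    The dual representation needs countably additive probabilities, whereas
    continuity from below only gives a Fatou property; the usual proof appeals
    to the Krein-Smulian theorem. Here a convex set [U] of perturbations is built
    height by height so that [price (X0 - W)] stays near [price X0] for all [W] in
    [U] ([monetary_neighbourhood]). At each step, if no tolerance worked, convex
    sets of bad perturbations would decrease to an impossible limit; the limit
    exists because decreasing nonempty convex sets of uniformly bounded functions
    have an almost surely convergent selection, obtained by minimising the second
    moment ([convex_ae_selection]). The Hahn-Banach theorem then gives a linear
    form that nearly supports [price] at [X0] and is bounded above on [U], and
    this bound is what makes it countably additive ([monetary_dual]). *)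

(** * Linear minorants of sublinear functionals *)

Lemma inf_le_add (R : realType) (A B C : set R) :
  A !=set0 -> B !=set0 -> has_lbound C ->
  (forall a b, A a -> B b -> exists2 c, C c & c <= a + b) ->
  inf C <= inf A + inf B.
Proof.
move=> A0 B0 lC ABC.
rewrite -lerBlDr; apply: lb_le_inf => // a Aa.
rewrite lerBlDr addrC -lerBlDr; apply: lb_le_inf => // b Bb.
have [c Cc cab] := ABC _ _ Aa Bb.
rewrite lerBlDr addrC; apply: le_trans cab; exact: ge_inf.
Qed.

Lemma inf_le_scale (R : realType) (A C : set R) (t : R) :
  A !=set0 -> has_lbound C -> 0 <= t ->
  (forall a, A a -> exists2 c, C c & c <= t * a) -> inf C <= t * inf A.
Proof.
move=> A0 lC; rewrite le_eqVlt => /predU1P[<-|t0] AC.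
  have [a Aa] := A0; have [c Cc] := AC _ Aa.
  by rewrite !mul0r; apply: le_trans; exact: ge_inf.
rewrite mulrC -ler_pdivrMr//; apply: lb_le_inf => // a Aa.
rewrite ler_pdivrMr// mulrC; have [c Cc ca] := AC _ Aa.
by apply: le_trans ca; exact: ge_inf.
Qed.

Section HahnBanach.
Context (R : realType) (V : lmodType R) (L : set V).
Hypothesis LD : forall x y, L x -> L y -> L (x + y).
Hypothesis LZ : forall (t : R) x, L x -> L (t *: x).

Definition sublinear_on (q : V -> R) :=
  (forall x y, L x -> L y -> q (x + y) <= q x + q y) /\
  (forall (t : R) x, 0 <= t -> L x -> q (t *: x) <= t * q x).

Let LN x : L x -> L (- x).
Proof. by move=> Lx; rewrite -scaleN1r; exact: LZ. Qed.

Lemma sublinear_on0 q x : sublinear_on q -> L x -> q 0 = 0.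
Proof.
move=> [qD qZ] Lx; have L0 : L 0 by rewrite -(scale0r x); exact: LZ.
apply/eqP; rewrite eq_le; apply/andP; split.
  by have := qZ 0 x (lexx _) Lx; rewrite scale0r mul0r.
by have := qD 0 0 L0 L0; rewrite addr0 -[leLHS]addr0 lerD2l.
Qed.

Lemma sublinear_on_scale q t x : sublinear_on q -> 0 <= t -> L x ->
  q (t *: x) = t * q x.
Proof.
move=> sq; rewrite le_eqVlt => /predU1P[<- Lx|t0 Lx].
  by rewrite scale0r mul0r (sublinear_on0 sq Lx).
have [_ qZ] := sq; apply/eqP; rewrite eq_le qZ ?(ltW t0)//=.
rewrite -ler_pdivlMl// -[in leLHS](scale1r x) -(mulVf (lt0r_neq0 t0)) -scalerA.
by apply: qZ; [rewrite invr_ge0 ltW|exact: LZ].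
Qed.

Lemma sublinear_onN q x : sublinear_on q -> L x -> - q (- x) <= q x.
Proof.
move=> sq Lx; have := sq.1 _ _ Lx (LN Lx).
by rewrite subrr (sublinear_on0 sq Lx); lra.
Qed.

(** A sublinear functional can be lowered along any direction [a] so as to
    become odd there; hence one that is minimal is already linear. *)
Lemma minimal_sublinear_odd q a : L a -> sublinear_on q ->
  (forall r, sublinear_on r -> (forall x, L x -> r x <= q x) ->
     forall x, L x -> q x <= r x) ->
  q (- a) = - q a.
Proof.
move=> La sq qmin.
pose E x := [set q (x + t *: a) - t * q a | t in [set t | 0 <= t]].
have E0 x : E x !=set0 by exists (q (x + 0 *: a) - 0 * q a); exists 0 => /=.
have Elb x : L x -> has_lbound (E x).
  move=> Lx; exists (- q (- x)) => _ [t /= t0 <-].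
  rewrite -(sublinear_on_scale sq t0 La).
  have := sq.1 _ _ (LD Lx (LZ t La)) (LN Lx).
  by rewrite addrAC subrr add0r; lra.
pose r x := inf (E x).
have Er x t : L x -> 0 <= t -> r x <= q (x + t *: a) - t * q a.
  by move=> Lx t0; apply: ge_inf; [exact: Elb|exists t].
have sr : sublinear_on r.
  split=> [x y Lx Ly|t x t0 Lx].
    apply: inf_le_add => //; first exact/Elb/LD.
    move=> _ _ [s /= s0 <-] [t /= t0 <-].
    exists (q (x + y + (s + t) *: a) - (s + t) * q a).
      by exists (s + t) => //=; exact: addr_ge0.
    have := sq.1 _ _ (LD Lx (LZ s La)) (LD Ly (LZ t La)).
    by rewrite addrACA -scalerDl; lra.
  apply: inf_le_scale => //; first exact/Elb/LZ.
  move=> _ [s /= s0 <-].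
  exists (q (t *: x + (t * s) *: a) - (t * s) * q a).
    by exists (t * s) => //=; exact: mulr_ge0.
  rewrite -scalerA -scalerDr mulrBr mulrA lerB//.
  by apply: sq.2 => //; exact/LD/LZ.
have rq x : L x -> r x <= q x.
  by move=> Lx; have := Er x 0 Lx (lexx _); rewrite scale0r addr0 mul0r subr0.
have := qmin _ sr rq _ (LN La).
have := Er _ 1 (LN La) ler01.
rewrite scale1r addNr mul1r (sublinear_on0 sq La) sub0r => h1 h2.
apply/eqP; rewrite eq_le (le_trans h2 h1)/=.
by have := sublinear_onN sq (LN La); rewrite opprK.
Qed.

Lemma exists_minimal_sublinear p x0 : L x0 -> sublinear_on p ->
  exists q, [/\ sublinear_on q, (forall x, L x -> q x <= p x) &
    forall r, sublinear_on r -> (forall x, L x -> r x <= q x) ->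
     forall x, L x -> q x <= r x].
Proof.
move=> Lx0 sp.
pose T := {q | sublinear_on q /\ forall x, L x -> q x <= p x}.
pose le (q r : T) := `[< forall x, L x -> sval r x <= sval q x >].
have p0 : T by exists p.
have lerefl q : le q q by apply/asboolP.
have letr q r s : le q r -> le r s -> le q s.
  move=> /asboolP qr /asboolP rs; apply/asboolP => x Lx.
  exact: le_trans (rs _ Lx) (qr _ Lx).
have [|q qmax] := @ZL_preorder T p0 le lerefl letr; last first.
  exists (sval q); case: (svalP q) => sq qp; split => // r sr rq.
  have rp x : L x -> r x <= p x by move=> Lx; apply: le_trans (qp _ Lx); exact: rq.
  have /asboolP := qmax (exist _ r (conj sr rp)) (introT (asboolP _) rq).
  exact.
move=> A Atot.
have [->|/set0P[a Aa]] := eqVneq A set0; first by exists p0.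
pose E x := [set sval q x | q in A].
have E0 x : E x !=set0 by exists (sval a x); exists a.
have Elb x : L x -> has_lbound (E x).
  move=> Lx; exists (- p (- x)) => _ [q Aq <-].
  have [sq qp] := svalP q; apply: le_trans (sublinear_onN sq Lx).
  by rewrite lerN2; exact/qp/LN.
pose r x := inf (E x).
have Er x q : L x -> A q -> r x <= sval q x.
  by move=> Lx Aq; apply: ge_inf; [exact: Elb|exists q].
have sr : sublinear_on r.
  split=> [x y Lx Ly|t x t0 Lx].
    apply: inf_le_add => //; first exact/Elb/LD.
    move=> _ _ [q Aq <-] [s As <-].
    have [sq _] := svalP q; have [ss _] := svalP s.
    have [/asboolP qs|/asboolP qs] := Atot _ _ Aq As.
      exists (sval s (x + y)); first by exists s.
      by apply: le_trans (ss.1 _ _ Lx Ly) _; rewrite lerD2r qs.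
    exists (sval q (x + y)); first by exists q.
    by apply: le_trans (sq.1 _ _ Lx Ly) _; rewrite lerD2l qs.
  apply: inf_le_scale => //; first exact/Elb/LZ.
  move=> _ [q Aq <-]; exists (sval q (t *: x)); first by exists q.
  by have [sq _] := svalP q; exact: sq.2.
have rp x : L x -> r x <= p x.
  by move=> Lx; have [_ ap] := svalP a; apply: le_trans (ap _ Lx); exact: Er.
exists (exist _ r (conj sr rp)) => s As; apply/asboolP => x Lx /=.
exact: Er.
Qed.

(** The Hahn-Banach theorem. Zorn's lemma is applied to sublinear functionals
    on all of [L], so no partially defined linear form has to be extended. *)
Lemma hahn_banach_sublinear p x0 : L x0 -> sublinear_on p ->
  exists l : V -> R,
  [/\ (forall x y, L x -> L y -> l (x + y) = l x + l y),
      (forall (t : R) x, L x -> l (t *: x) = t * l x) &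
      (forall x, L x -> l x <= p x)].
Proof.
move=> Lx0 sp; have [l [sl lp lmin]] := exists_minimal_sublinear Lx0 sp.
have odd x : L x -> l (- x) = - l x.
  by move=> Lx; exact: minimal_sublinear_odd.
exists l; split => // [x y Lx Ly|t x Lx].
  apply/eqP; rewrite eq_le sl.1//=.
  by have := sl.1 _ _ (LD Lx Ly) (LN Ly); rewrite addrK (odd _ Ly); lra.
have [t0|t0] := leP 0 t; first exact: sublinear_on_scale.
rewrite -[t]opprK scaleNr odd; last exact: LZ.
by rewrite (sublinear_on_scale sl) ?mulNr// oppr_ge0 ltW.
Qed.

End HahnBanach.

(** * Bounded measurable functions *)

Section BoundedMeasurable.
Context (R : realType) (disp : measure_display) (T : measurableType disp).
Implicit Types (X Y : T -> R) (Q : probability T R).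

Definition bounded_measurable : set (T -> R) :=
  [set X : T -> R | measurable_fun [set: T] X /\ exists M, forall w, `|X w| <= M].

Lemma bm_cst c : bounded_measurable (cst c).
Proof. by split => //; exists `|c|. Qed.

Lemma bmD X Y : bounded_measurable X -> bounded_measurable Y ->
  bounded_measurable (fun w => X w + Y w).
Proof.
move=> [mX [M XM]] [mY [N YN]]; split; first exact: measurable_funD.
by exists (M + N) => w; apply: le_trans (ler_normD _ _) _; exact: lerD.
Qed.

Lemma bmM X Y : bounded_measurable X -> bounded_measurable Y ->
  bounded_measurable (fun w => X w * Y w).
Proof.
move=> [mX [M XM]] [mY [N YN]]; split; first exact: measurable_funM.
by exists (M * N) => w; rewrite normrM; exact: ler_pM.
Qed.

Lemma bmZ c X : bounded_measurable X -> bounded_measurable (fun w => c * X w).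
Proof. exact/bmM/bm_cst. Qed.

Lemma bmN X : bounded_measurable X -> bounded_measurable (fun w => - X w).
Proof.
by move=> /(bmZ (-1)); congr bounded_measurable; apply/funext => w; rewrite mulN1r.
Qed.

Lemma bmB X Y : bounded_measurable X -> bounded_measurable Y ->
  bounded_measurable (fun w => X w - Y w).
Proof. by move=> bX bY; exact/bmD/bmN. Qed.

Lemma bm_min X Y : bounded_measurable X -> bounded_measurable Y ->
  bounded_measurable (fun w => Num.min (X w) (Y w)).
Proof.
move=> [mX [M XM]] [mY [N YN]]; split; first exact: measurable_minr.
exists (Num.max M N) => w.
by rewrite minEle; case: ifP => _; rewrite le_max ?XM ?YN ?orbT.
Qed.

Lemma bm_max X Y : bounded_measurable X -> bounded_measurable Y ->
  bounded_measurable (fun w => Num.max (X w) (Y w)).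
Proof.
move=> [mX [M XM]] [mY [N YN]]; split; first exact: measurable_maxr.
exists (Num.max M N) => w.
by rewrite maxEle; case: ifP => _; rewrite le_max ?XM ?YN ?orbT.
Qed.

Lemma bm_indic (D : set T) : measurable D -> bounded_measurable (\1_D : T -> R).
Proof.
move=> mD; split; first exact: measurable_indic.
by exists 1 => w; rewrite indicE normr_nat; case: (_ \in _).
Qed.

Lemma bm_integrable Q X : bounded_measurable X -> Q.-integrable setT (EFin \o X).
Proof.
move=> [mX [M XM]]; apply: measurable_bounded_integrable => //.
  by rewrite (le_lt_trans (probability_le1 _ _)) ?ltry.
by exists M; split; [exact: num_real|move=> N MN w _; exact: le_trans (XM w) (ltW MN)].
Qed.

Lemma RintD Q X Y : bounded_measurable X -> bounded_measurable Y ->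
  \int[Q]_w (X w + Y w) = \int[Q]_w X w + \int[Q]_w Y w.
Proof. by move=> bX bY; apply: RintegralD => //; exact: bm_integrable. Qed.

Lemma RintB Q X Y : bounded_measurable X -> bounded_measurable Y ->
  \int[Q]_w (X w - Y w) = \int[Q]_w X w - \int[Q]_w Y w.
Proof. by move=> bX bY; apply: RintegralB => //; exact: bm_integrable. Qed.

Lemma RintZ Q c X : bounded_measurable X ->
  \int[Q]_w (c * X w) = c * \int[Q]_w X w.
Proof. by move=> bX; apply: RintegralZl => //; exact: bm_integrable. Qed.

Lemma le_Rint Q X Y : bounded_measurable X -> bounded_measurable Y ->
  (forall w, X w <= Y w) -> \int[Q]_w X w <= \int[Q]_w Y w.
Proof. by move=> bX bY XY; apply: le_Rintegral => //; exact: bm_integrable. Qed.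

Lemma Rint_cst Q c : \int[Q]_(w in [set: T]) c = c :> R.
Proof.
rewrite Rintegral_cst// -[RHS]mulr1; congr (_ * _).
exact: (congr1 fine (probability_setT Q)).
Qed.

Lemma Rint_indic Q (D : set T) : measurable D ->
  \int[Q]_w (\1_D w : R) = fine (Q D).
Proof. by move=> mD; rewrite /Rintegral integral_indic// setIT. Qed.

Lemma Rint_EFin Q X : bounded_measurable X ->
  (\int[Q]_w X w)%:E = (\int[Q]_w (X w)%:E)%E.
Proof.
by move=> bX; rewrite fineK//; apply: integrable_fin_num => //; exact: bm_integrable.
Qed.

Lemma Rint_cvg Q (X_ : nat -> T -> R) X M :
  (forall n, measurable_fun [set: T] (X_ n)) -> measurable_fun [set: T] X ->
  (forall n w, `|X_ n w| <= M) ->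
  (\forall w \ae Q, X_ n w @[n --> \oo] --> X w) ->
  \int[Q]_w X_ n w @[n --> \oo] --> \int[Q]_w X w.
Proof.
move=> mX_ mX XM cX.
have [|||||iX _ cI] := @dominated_convergence _ _ _ Q setT measurableT
    (fun n => EFin \o X_ n) (EFin \o X) (cst M%:E).
- by move=> n; exact/measurable_EFinP.
- exact/measurable_EFinP.
- by apply: filterS cX => w cw _; exact: cvg_EFin (nearW _ _) cw.
- exact: (bm_integrable _ (bm_cst M)).
- by apply: nearW => w n _; rewrite lee_fin.
apply: fine_cvg; rewrite fineK; first exact: cI.
exact: integrable_fin_num.
Qed.

End BoundedMeasurable.
Arguments bounded_measurable {R disp T}.

(** * Monetary functionals and the Fatou property *)

Section Monetary.
Context (R : realType) (disp : measure_display) (T : measurableType disp).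
Variable P : probability T R.

Definition monetary (rho : (T -> R) -> R) :=
  [/\ (forall X Y, bounded_measurable X -> bounded_measurable Y ->
         (\forall w \ae P, X w <= Y w) -> rho X <= rho Y),
      (forall X c, bounded_measurable X ->
         rho (fun w => X w + c) = rho X + c),
      (forall X Y (l : R), bounded_measurable X -> bounded_measurable Y ->
         0 <= l <= 1 ->
         rho (fun w => l * X w + (1 - l) * Y w) <= l * rho X + (1 - l) * rho Y),
      rho (cst 0) = 0 &
      (forall (X_ : nat -> T -> R) X,
         (forall n, bounded_measurable (X_ n)) -> bounded_measurable X ->
         (forall n, \forall w \ae P, X_ n w <= X_ n.+1 w) ->
         (\forall w \ae P, X_ n w @[n --> \oo] --> X w) ->
         rho (X_ n) @[n --> \oo] --> rho X)].

Lemma monetary_ae_eq rho X Y : monetary rho ->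
  bounded_measurable X -> bounded_measurable Y ->
  (\forall w \ae P, X w = Y w) -> rho X = rho Y.
Proof.
move=> [mono _ _ _ _] bX bY XY; apply/eqP; rewrite eq_le; apply/andP.
by split; apply: mono => //; apply: filterS XY => w ->.
Qed.

(** The infima of the tails of a bounded convergent sequence increase to its
    limit, so continuity from below gives lower semicontinuity for bounded
    almost sure convergence. *)
Lemma monetary_fatou rho (X_ : nat -> T -> R) X M a : monetary rho ->
  (forall n, measurable_fun [set: T] (X_ n)) -> bounded_measurable X ->
  (forall n w, `|X_ n w| <= M) ->
  (\forall w \ae P, X_ n w @[n --> \oo] --> X w) ->
  (forall n, rho (X_ n) <= a) -> rho X <= a.
Proof.
move=> [mono _ _ _ cfb] mX_ bX XM cX Xa.
pose Y_ n w := infs (X_ ^~ w) n.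
have lb w : has_lbound (range (X_ ^~ w)).
  by exists (- M) => _ [n _ <-]; have := XM n w; rewrite ler_norml => /andP[].
have ub w : has_ubound (range (X_ ^~ w)).
  by exists M => _ [n _ <-]; have := XM n w; rewrite ler_norml => /andP[].
have Y_X n w : Y_ n w <= X_ n w.
  by apply: ge_inf; [exact: has_lbound_sdrop|exists n => //=].
have bX_ n : bounded_measurable (X_ n) by split => //; exists M.
have bY_ n : bounded_measurable (Y_ n).
  split; first by apply: measurable_fun_infs => // t _; exact: lb.
  exists M => w; rewrite ler_norml; apply/andP; split; last first.
    by apply: le_trans (Y_X n w) _; have := XM n w; rewrite ler_norml => /andP[].
  apply: lb_le_inf; first by exists (X_ n w), n => //=.
  by move=> _ [m /= nm <-]; have := XM m w; rewrite ler_norml => /andP[].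
have Yinc n : \forall w \ae P, Y_ n w <= Y_ n.+1 w.
  by apply: nearW => w; exact: (nondecreasing_infs (lb w)).
have cY : \forall w \ae P, Y_ n w @[n --> \oo] --> X w.
  by apply: filterS cX => w; exact: cvg_infs.
have /cvg_lim <- // := cfb _ _ bY_ bX Yinc cY.
apply: limr_le; first by apply/cvg_ex; eexists; exact: cfb bY_ bX Yinc cY.
apply: nearW => n; apply: le_trans (Xa n); apply: mono => //.
by apply: nearW => w; exact: Y_X.
Qed.

End Monetary.

(** * Almost surely convergent selections from decreasing convex sets *)

Section Selection.
Context (R : realType) (disp : measure_display) (T : measurableType disp).
Variable P : probability T R.

Let halfpow (k : nat) : R := 1 / (2 ^ (k + 1))%:R.

Let halfpow_gt0 k : 0 < halfpow k.
Proof. by rewrite divr_gt0// ltr0n expn_gt0. Qed.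

Let halfpow_dec k : halfpow k.+1 <= halfpow k.
Proof.
rewrite ler_pM2l// lef_pV2 ?posrE ?ltr0n ?expn_gt0//.
by rewrite ler_nat leq_exp2l.
Qed.

(** The expected total variation of the sequence is finite, so the total
    variation is almost surely finite. *)
Lemma ae_cvg_summable_increments (V_ : nat -> T -> R) :
  (forall n, bounded_measurable (V_ n)) ->
  (forall n, \int[P]_w `|V_ n.+1 w - V_ n w| <= 2 * halfpow n) ->
  \forall w \ae P, cvgn (V_ ^~ w : nat -> R^o).
Proof.
move=> bV dV.
pose D n w : \bar R := `|V_ n.+1 w - V_ n w|%:E.
have bD n : bounded_measurable (fun w => `|V_ n.+1 w - V_ n w|).
  have [mB [M BM]] := bmB (bV n.+1) (bV n).
  split; first exact: measurableT_comp.
  by exists M => w; rewrite normr_id.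
have mD n : measurable_fun setT (D n) by apply/measurable_EFinP; case: (bD n).
have D0 n w : (0 <= D n w)%E by rewrite lee_fin.
have mS : measurable_fun setT (fun w => \sum_(0 <= n <oo) D n w)%E.
  exact: ge0_emeasurable_sum.
have IS : (\int[P]_w (\sum_(0 <= n <oo) D n w) <= 2%:E)%E.
  rewrite integral_nneseries//.
  have -> : 2%:E = (\sum_(0 <= n <oo) (2 * halfpow n)%:E)%E :> \bar R.
    under eq_eseriesr do rewrite EFinM.
    rewrite nneseriesZl//; last by move=> n _; rewrite lee_fin ltW.
    have /cvg_lim -> // := @cvg_geometric_eseries_half R 1 0.
    by rewrite expr0 divr1 mule1.
  apply: lee_nneseries => [n _ _|n _]; first exact: integral_ge0.
  by rewrite -Rint_EFin// lee_fin.
have iS : P.-integrable setT (fun w => \sum_(0 <= n <oo) D n w)%E.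
  apply/integrableP; split => //.
  under eq_integral do rewrite gee0_abs ?nneseries_ge0//.
  by rewrite (le_lt_trans IS)// ltry.
apply: filterS (integrable_ae measurableT iS) => w /(_ I) Sfin.
have -> : V_ ^~ w = (fun n => V_ 0%N w + series (telescope (V_ ^~ w)) n).
  by apply/funext => n; rewrite -eq_sum_telescope.
apply: is_cvgD; first exact: is_cvg_cst.
apply: (@normed_cvg R R^o).
apply: nondecreasing_is_cvgn.
  by apply: nondecreasing_series => n _ _; exact: normr_ge0.
exists (fine (\sum_(0 <= n <oo) D n w)%E) => _ [n _ <-].
rewrite -lee_fin fineK// /series /= -sumEFin.
exact: (@nneseries_lim_ge R (D ^~ w) xpredT 0 n).
Qed.

(** Almost minimisers of [E (W ^ 2)] over the sets [C j] form, by the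
    parallelogram identity, a Cauchy sequence in [L^2]: the midpoint of two of
    them cannot have a much smaller second moment. *)
Lemma convex_ae_selection (C : nat -> set (T -> R)) (b : R) :
  (forall j W, C j W -> measurable_fun setT W /\ forall w, 0 <= W w <= b) ->
  (forall j, C j !=set0) ->
  (forall i j, (i <= j)%N -> C j `<=` C i) ->
  (forall j (l : R) W W', 0 <= l <= 1 -> C j W -> C j W' ->
     C j (fun w => l * W w + (1 - l) * W' w)) ->
  exists (V_ : nat -> T -> R) (V : T -> R),
  [/\ (forall j, C j (V_ j)), measurable_fun setT V,
      (forall w, 0 <= V w <= b) &
      \forall w \ae P, V_ n w @[n --> \oo] --> V w].
Proof.
move=> CW C0 Cdec Cconv.
have Cmid j W W' : C j W -> C j W' -> C j (fun w => 2^-1 * W w + 2^-1 * W' w).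
  move=> CjW CjW'.
  have -> : (fun w => 2^-1 * W w + 2^-1 * W' w)
      = (fun w => 2^-1 * W w + (1 - 2^-1) * W' w) by apply/funext => w; field.
  by apply: Cconv => //; lra.
pose sq (W : T -> R) := \int[P]_w (W w * W w).
have Cb j W : C j W -> bounded_measurable W.
  move=> /CW[mW W0b]; split => //; exists b => w.
  by have /andP[W0 Wb] := W0b w; rewrite ger0_norm.
have sq0 j W : C j W -> 0 <= sq W.
  by move=> _; apply: Rintegral_ge0 => w _; exact: sqr_ge0.
have sqb j W : C j W -> sq W <= b * b.
  move=> CjW; rewrite -(Rint_cst P (b * b)); apply: le_Rint => [||w].
  - by apply: bmM; exact: Cb CjW.
  - exact: bm_cst.
  - by have [_ /(_ w) /andP[W0 Wb]] := CW _ _ CjW; exact: ler_pM.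
pose m j := inf [set sq W | W in C j].
have mle j W : C j W -> m j <= sq W.
  move=> CjW; apply: ge_inf; last by exists W.
  by exists 0 => _ [W' CjW' <-]; exact: sq0 CjW'.
pose M := sup (range m).
have mub : has_ubound (range m).
  exists (b * b) => _ [j _ <-]; have [W CjW] := C0 j.
  exact: le_trans (mle _ _ CjW) (sqb _ _ CjW).
have mM j : m j <= M by apply: ub_le_sup => //; exists j.
pose eta k := halfpow k * halfpow k / 8.
have eta_gt0 k : 0 < eta k by rewrite !mulr_gt0// invr_gt0.
have eta_dec k : eta k.+1 <= eta k.
  by rewrite ler_pM2r ?invr_gt0// ler_pM ?halfpow_dec// ltW.
(* [V_ k] nearly minimises the second moment over a set [C j] whose minimum is
   itself nearly the limit [M] of the minima *)
have sel k : exists W, [/\ C k W, sq W <= M + eta k &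
    exists j, C j W /\ M - eta k <= m j].
  have [_ [j _ <-] Mj] : exists2 x, range m x & M - eta k < x.
    by apply: sup_adherent => //; split => //; exists (m 0%N), 0%N.
  pose i := maxn j k.
  have mi : M - eta k <= m i.
    apply: le_trans (ltW Mj) _; apply: lb_le_inf.
      by have [W CiW] := C0 i; exists (sq W), W.
    by move=> _ [W /(Cdec j i (leq_maxl _ _)) CjW <-]; exact: mle.
  have [_ [W CiW <-] Wm] : exists2 x, [set sq W | W in C i] x & x < m i + eta k.
    apply: inf_adherent => //; split.
      by have [W CiW] := C0 i; exists (sq W), W.
    by exists 0 => _ [W' CjW' <-]; exact: sq0 CjW'.
  exists W; split.
  - by apply: Cdec CiW; exact: leq_maxr.
  - by apply: le_trans (ltW Wm) _; rewrite lerD2r.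
  - by exists i.
have [V_ V_P] := choice sel.
have CV k : C k (V_ k) by case: (V_P k).
have bV k : bounded_measurable (V_ k) by exact: Cb (CV k).
have d2 k : \int[P]_w ((V_ k.+1 w - V_ k w) * (V_ k.+1 w - V_ k w))
    <= halfpow k * halfpow k.
  have [_ sk [j [Cj mj]]] := V_P k; have [_ sk1 [j1 [Cj1 mj1]]] := V_P k.+1.
  pose A w := 2^-1 * V_ k.+1 w + 2^-1 * V_ k w.
  have mA : M - eta k <= sq A.
    have [jj1|/ltnW j1j] := leqP j j1.
      by apply: le_trans mj _; apply: mle; exact: Cmid (Cdec _ _ jj1 _ Cj1) Cj.
    apply: le_trans (le_trans mj1 _); first by rewrite lerB.
    by apply: mle; exact: Cmid Cj1 (Cdec _ _ j1j _ Cj).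
  have bA : bounded_measurable A by apply: bmD; exact: bmZ.
  have -> : \int[P]_w ((V_ k.+1 w - V_ k w) * (V_ k.+1 w - V_ k w)) =
      2 * sq (V_ k.+1) + 2 * sq (V_ k) - 4 * sq A.
    under eq_Rintegral => w _.
      rewrite (_ : _ * _ = 2 * (V_ k.+1 w * V_ k.+1 w) + 2 * (V_ k w * V_ k w)
        - 4 * (A w * A w)); last by rewrite /A; field.
      over.
    have bVV n : bounded_measurable (fun w => V_ n w * V_ n w) by exact: bmM.
    rewrite RintB ?RintD ?RintZ//; do ?[exact: bmM|exact: bmZ].
    - by apply: bmD; exact: bmZ.
    - by apply: bmZ; exact: bmM.
  have := eta_dec k.
  have -> : halfpow k * halfpow k = 8 * eta k by rewrite /eta; field.
  move: sk sk1 mA; lra.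
have dV k : \int[P]_w `|V_ k.+1 w - V_ k w| <= 2 * halfpow k.
  pose B w := V_ k.+1 w - V_ k w.
  have bB : bounded_measurable B by exact: bmB.
  (* pointwise, |x| <= x^2 / h + h for every h > 0 *)
  apply: (@le_trans _ _ (\int[P]_w ((halfpow k)^-1 * (B w * B w) + halfpow k))).
    apply: le_Rint => [||w].
    - have [mB [N BN]] := bB; split; first exact: measurableT_comp.
      by exists N => w; rewrite normr_id; exact: BN.
    - by apply: bmD; [apply: bmZ; exact: bmM|exact: bm_cst].
    - have h0 := halfpow_gt0 k.
      have -> : B w * B w = `|B w| * `|B w|.
        by rewrite -normrM ger0_norm// -expr2 sqr_ge0.
      rewrite -/(B w) -(ler_pM2l h0) mulrDr mulVKf ?gt_eqF//.
      have := sqr_ge0 (`|B w| - halfpow k); rewrite sqrrB !expr2.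
      have := mulr_ge0 (ltW h0) (normr_ge0 (B w)); lra.
  rewrite RintD ?Rint_cst; [|by apply: bmZ; exact: bmM|exact: bm_cst].
  rewrite RintZ; last exact: bmM.
  rewrite mulr2n mulrDl mul1r lerD2r mulrC ler_pdivrMr//; exact: d2.
have cV := ae_cvg_summable_increments bV dV.
exists V_, (fun w => limn_sup (V_ ^~ w)).
have lbV w : has_lbound (range (V_ ^~ w)).
  by exists 0 => _ [n _ <-]; have [_ /(_ w) /andP[]] := CW _ _ (CV n).
have ubV w : has_ubound (range (V_ ^~ w)).
  by exists b => _ [n _ <-]; have [_ /(_ w) /andP[]] := CW _ _ (CV n).
split => //.
- apply: measurable_fun_limn_sup => [w _|w _|n]; [exact: ubV|exact: lbV|].
  by have [] := CW _ _ (CV n).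
- move=> w.
  have V0b n : 0 <= V_ n w <= b by have [_ /(_ w)] := CW _ _ (CV n).
  have /cvg_lim cs := cvg_sups_inf (ubV w) (lbV w).
  have cw : cvgn (sups (V_ ^~ w)).
    by apply/cvg_ex; eexists; exact: cvg_sups_inf.
  rewrite /limn_sup; apply/andP; split.
    apply: limr_ge => //; apply: nearW => n.
    have /andP[/le_trans + _] := V0b n; apply.
    by apply: ub_le_sup; [exact: has_ubound_sdrop|exists n => /=].
  apply: limr_le => //; apply: nearW => n.
  apply: ge_sup; first by exists (V_ n w), n => /=.
  by move=> _ [k /= _ <-]; have /andP[] := V0b k.
- by apply: filterS cV => w cw; rewrite cvg_limn_supE.
Qed.

End Selection.

(** * A neighbourhood on which a monetary functional stays large *)

Section Neighbourhood.
Context (R : realType) (disp : measure_display) (T : measurableType disp).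
Variable P : probability T R.
Implicit Types W : T -> R.

Definition excess (W : T -> R) (c : R) : R := \int[P]_w Num.max (W w - c) 0.

Lemma bm_excess W c : bounded_measurable W ->
  bounded_measurable (fun w => Num.max (W w - c) 0).
Proof.
by move=> bW; apply: bm_max; [apply: bmB => //; exact: bm_cst|exact: bm_cst].
Qed.

Lemma excess_conv (l : R) W W' c : 0 <= l <= 1 ->
  bounded_measurable W -> bounded_measurable W' ->
  excess (fun w => l * W w + (1 - l) * W' w) c
    <= l * excess W c + (1 - l) * excess W' c.
Proof.
move=> /andP[l0 l1] bW bW'; rewrite /excess.
have bWc := bm_excess c bW; have bWc' := bm_excess c bW'.
rewrite -!RintZ// -RintD; [|exact: bmZ|exact: bmZ].
apply: le_Rint => [||w].
- by apply: bm_excess; apply: bmD; exact: bmZ.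
- by apply: bmD; exact: bmZ.
- have l1' : 0 <= 1 - l by rewrite subr_ge0.
  rewrite ge_max; apply/andP; split; last first.
    by apply: addr_ge0; apply: mulr_ge0 => //; rewrite le_max lexx orbT.
  apply: (@le_trans _ _ (l * (W w - c) + (1 - l) * (W' w - c))); first lra.
  by apply: lerD; apply: ler_wpM2l => //; rewrite le_max lexx.
Qed.

Lemma excess_le_conv (l : R) W W' c r : 0 <= l <= 1 ->
  bounded_measurable W -> bounded_measurable W' ->
  excess W c <= r -> excess W' c <= r ->
  excess (fun w => l * W w + (1 - l) * W' w) c <= r.
Proof.
move=> l01 bW bW' Wr Wr'; apply: (le_trans (excess_conv _ l01 bW bW')).
case/andP: l01 => l0 l1; have l1' : 0 <= 1 - l by rewrite subr_ge0.
by have := ler_wpM2l l0 Wr; have := ler_wpM2l l1' Wr'; lra.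
Qed.

Lemma excess_cvg (W_ : nat -> T -> R) W c b :
  (forall n, measurable_fun [set: T] (W_ n)) -> measurable_fun [set: T] W ->
  (forall n w, 0 <= W_ n w <= b) ->
  (\forall w \ae P, W_ n w @[n --> \oo] --> W w) ->
  excess (W_ n) c @[n --> \oo] --> excess W c.
Proof.
move=> mW_ mW W_b cW.
apply: (@Rint_cvg _ _ _ _ _ _ (`|b| + `|c|)).
- move=> n; apply: measurable_maxr => //; exact: measurable_funB.
- by apply: measurable_maxr => //; exact: measurable_funB.
- move=> n w; have /andP[W0 Wb] := W_b n w.
  have cn := ler_norm (- c); rewrite normrN in cn.
  rewrite ger0_norm ?le_max ?lexx ?orbT// ge_max addr_ge0// andbT lerD//.
  exact: le_trans Wb (ler_norm _).
- apply: filterS cW => w cw.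
  under eq_fun do rewrite maxr_absE subr0 addr0.
  rewrite maxr_absE subr0 addr0.
  have cwc : W_ n w - c @[n --> \oo] --> W w - c by apply: cvgB => //; exact: cvg_cst.
  by apply: cvgMl; apply: cvgD => //; exact: cvg_norm.
Qed.

Variables (rho : (T -> R) -> R) (X0 : T -> R) (e : R).
Hypotheses (mrho : monetary P rho) (bX0 : bounded_measurable X0) (e0 : 0 < e).

(** [K s] imposes the first [size s] tolerances on functions bounded by the
    height that follows the last of them. *)
Let K (s : seq R) := [set W : T -> R | [/\ bounded_measurable W,
  (forall w, 0 <= W w <= (size s).+1%:R * e) &
  forall n, (n < size s)%N -> excess W (n.+1%:R * e) <= nth 0 s n]].

(** The slack [e / (size s).+1] decreases with the length of [s]; what it loses
    at each step leaves room for a further tolerance. *)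
Let good (s : seq R) := forall W, K s W ->
  rho X0 - 2 * e + e / (size s).+1%:R <= rho (fun w => X0 w - W w).

Let good_nil : good [::].
Proof.
move=> W [bW W0e _]; rewrite /= divr1.
rewrite (_ : _ + e = rho (fun w => X0 w + - e)); last first.
  by have [_ -> // _ _ _] := mrho; lra.
have [mono _ _ _ _] := mrho; apply: mono.
- by apply: bmD => //; exact: bm_cst.
- exact: bmB.
- by apply: nearW => w; rewrite lerD2l lerN2; have := W0e w; rewrite mul1r => /andP[].
Qed.

(** If no bound [d] worked, the sets of perturbations violating it would be
    nonempty, convex and decreasing as [d] tends to [0]; a selection would
    converge to a position that belongs to [K s] and violates [good s]. *)
Let good_rcons s : good s -> exists2 d, 0 < d & good (rcons s d).
Proof.
move=> gs; apply: contrapT => nd.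
set N := size s.
pose a := rho X0 - 2 * e + e / N.+2%:R.
pose C j := [set W | K (rcons s j.+1%:R^-1) W /\ rho (fun w => X0 w - W w) <= a].
have C0 j : C j !=set0.
  apply: contrapT => Cj0; apply: nd; exists (j.+1%:R^-1).
    by rewrite invr_gt0.
  move=> W KW; rewrite leNgt; apply/negP => rW; apply: Cj0; exists W; split => //.
  by apply: ltW; move: rW; rewrite size_rcons.
have CW j W : C j W -> measurable_fun setT W /\ forall w, 0 <= W w <= N.+2%:R * e.
  by move=> [[[mW _] + _] _]; rewrite size_rcons.
have Cdec i j : (i <= j)%N -> C j `<=` C i.
  move=> ij W [[bW W0 Wx] rW]; split => //; split => //.
    by move: W0; rewrite !size_rcons.
  move=> n; rewrite size_rcons => nN.
  apply: le_trans (Wx n _) _; first by rewrite size_rcons.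
  rewrite !nth_rcons; case: ifP => // _; case: ifP => // _.
  by rewrite lef_pV2 ?posrE// ler_nat.
have Cconv j (l : R) W W' : 0 <= l <= 1 -> C j W -> C j W' ->
    C j (fun w => l * W w + (1 - l) * W' w).
  move=> l01 [[bW W0 Wx] rW] [[bW' W0' Wx'] rW'].
  have /andP[l0 l1] := l01; have l1' : 0 <= 1 - l by rewrite subr_ge0.
  split; first split.
  - by apply: bmD; exact: bmZ.
  - move=> w; have /andP[Ww Ww1] := W0 w; have /andP[Ww' Ww1'] := W0' w.
    rewrite addr_ge0 ?mulr_ge0//=.
    have := ler_wpM2l l0 Ww1; have := ler_wpM2l l1' Ww1'; lra.
  - by move=> n nN; apply: excess_le_conv => //; [exact: Wx|exact: Wx'].
  have [_ _ conv _ _] := mrho.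
  have -> : (fun w => X0 w - (l * W w + (1 - l) * W' w)) =
      (fun w => l * (X0 w - W w) + (1 - l) * (X0 w - W' w)).
    by apply/funext => w; ring.
  apply: (le_trans (conv _ _ _ _ _ l01)); [exact: bmB|exact: bmB|].
  have := ler_wpM2l l0 rW; have := ler_wpM2l l1' rW'; lra.
have [V_ [V [CV mV V0b cV]]] := convex_ae_selection P CW C0 Cdec Cconv.
have V_b n w : 0 <= V_ n w <= N.+2%:R * e by have [_] := CW _ _ (CV n); exact.
have mV_ n : measurable_fun setT (V_ n) by have [] := CW _ _ (CV n).
have bV : bounded_measurable V.
  split => //; exists (N.+2%:R * e) => w.
  by have /andP[V0 Vb] := V0b w; rewrite ger0_norm.
have Vx n j : (n <= N)%N ->
    excess V (n.+1%:R * e) <= nth 0 (rcons s j.+1%:R^-1) n.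
  move=> nN.
  have cx : excess (V_ i) (n.+1%:R * e) @[i --> \oo] --> excess V (n.+1%:R * e).
    exact: excess_cvg mV_ mV V_b cV.
  have /cvg_lim <- // := cx.
  apply: limr_le; first by apply/cvg_ex; eexists; exact: cx.
  near=> i; have ji : (j <= i)%N by near: i; exists j.
  have [[_ _ h] _] := Cdec _ _ ji _ (CV i).
  by apply: h; rewrite size_rcons ltnS.
(* the excess of [V] above height [(N + 1) e] is below every [1 / (j + 1)] *)
have Vmax : \forall w \ae P, V w <= N.+1%:R * e.
  have bx := bm_excess (N.+1%:R * e) bV.
  have x0 w : 0 <= Num.max (V w - N.+1%:R * e) 0 by rewrite le_max lexx orbT.
  have V0 : excess V (N.+1%:R * e) = 0.
    apply/eqP; rewrite eq_le Rintegral_ge0// andbT.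
    apply/ler_addgt0Pr => d d0; rewrite add0r.
    have := Vx N (Num.truncn d^-1) (leqnn _); rewrite nth_rcons ltnn eqxx.
    move=> /le_trans; apply; rewrite -[leRHS]invrK lef_pV2 ?posrE ?invr_gt0//.
    exact/ltW/truncnS_gt.
  have := (ae_eq_integral_abs P measurableT (f := fun w =>
    (Num.max (V w - N.+1%:R * e) 0)%:E) _).1.
  rewrite (_ : (\int[P]_(x in [set: T]) _)%E = 0%E); last first.
    rewrite -[RHS](congr1 EFin V0) /excess Rint_EFin//.
    by apply: eq_integral => w _; rewrite gee0_abs// lee_fin.
  move=> /(_ _ erefl) h; apply: filterS (h _) => [w /(_ I)[] xw|].
    by rewrite -subr_le0 -xw le_max lexx.
  by apply/measurable_EFinP; case: bx.
pose V' w := Num.min (V w) (N.+1%:R * e).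
have bV' : bounded_measurable V' by apply: bm_min => //; exact: bm_cst.
have KV' : K s V'.
  split => // [w|n nN].
    have /andP[V0 _] := V0b w.
    by rewrite /V' le_min V0 mulr_ge0 ?(ltW e0)//= ge_min lexx orbT.
  apply: (@le_trans _ _ (excess V (n.+1%:R * e))).
    apply: le_Rint => [||w]; [exact: bm_excess|exact: bm_excess|].
    rewrite ge_max !le_max lexx orbT andbT; apply/orP; left.
    by rewrite lerD2r ge_min lexx.
  by have := Vx n 0 (ltnW nN); rewrite nth_rcons nN.
have rV : rho (fun w => X0 w - V w) <= a.
  have [mX0 [M X0M]] := bX0.
  apply: (@monetary_fatou _ _ _ _ rho (fun n w => X0 w - V_ n w) _
    (M + N.+2%:R * e) a mrho) => [n||n w||n].
  - exact: measurable_funB.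
  - exact: bmB.
  - apply: le_trans (ler_normB _ _) _; apply: lerD => //.
    by have /andP[V0 Vb] := V_b n w; rewrite ger0_norm.
  - by apply: filterS cV => w cw; apply: cvgB => //; exact: cvg_cst.
  - by have [] := CV n.
have := gs _ KV'.
have -> : rho (fun w => X0 w - V' w) = rho (fun w => X0 w - V w).
  apply: (monetary_ae_eq mrho); [exact: bmB|exact: bmB|].
  by apply: filterS Vmax => w Vw; rewrite /V' min_l.
move=> /le_trans/(_ rV); rewrite lerD2l ler_pM2l// lef_pV2 ?posrE// ler_nat.
by rewrite ltnn.
Unshelve. all: by end_near.
Qed.

(** Lower semicontinuity along bounded sequences is not lower semicontinuity
    in [L^1]: unbounded perturbations have to be penalised according to their
    height. The tolerance [delta n] above height [(n + 1) e] is chosen after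
    the tolerances at lower heights. The admitted perturbations [W] form a
    convex set that contains all small multiples of any bounded nonnegative
    function; up to symmetry, it is a neighbourhood of [0] for the mixed topology
    of the norms of [L^oo] and [L^1]. *)
Lemma monetary_neighbourhood : exists2 delta : nat -> R, (forall n, 0 < delta n) &
  forall W, bounded_measurable W -> (forall w, 0 <= W w) ->
    (forall n, excess W (n.+1%:R * e) <= delta n) ->
    rho X0 - 2 * e <= rho (fun w => X0 w - W w).
Proof.
have step (s : seq R) : exists d, 0 < d /\ (good s -> good (rcons s d)).
  have [/good_rcons[d d0 gd]|ngs] := pselect (good s); first by exists d.
  by exists 1; split.
have [d dP] := choice step.
pose s_ := fix s_ n := if n is m.+1 then rcons (s_ m) (d (s_ m)) else [::].
pose delta n := d (s_ n).
have s_E n : s_ n = mkseq delta n.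
  by elim: n => //= n IHn; rewrite mkseqS -IHn.
have gs n : good (s_ n).
  by elim: n => [|n IHn] /=; [exact: good_nil|exact: (dP _).2].
exists delta => [n|W bW W0 Wx]; first by have [] := dP (s_ n).
have [_ [M WM]] := bW.
pose N := Num.truncn (M / e).
have KW : K (s_ N) W.
  split => // [w|n].
    rewrite W0/= s_E size_mkseq; apply: (le_trans (le_trans (ler_norm _) (WM w))).
    rewrite -ler_pdivrMr//; apply: ltW; exact: truncnS_gt.
  by rewrite s_E size_mkseq => nN; rewrite nth_mkseq.
apply: le_trans (gs _ _ KW).
by rewrite lerDl divr_ge0// ltW.
Qed.

End Neighbourhood.

(** * Positive functionals that are represented by a probability *)

Section Representation.
Context (R : realType) (disp : measure_display) (T : measurableType disp).
Variables (P : probability T R) (l : (T -> R) -> R).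
Hypothesis lD : forall X Y, bounded_measurable X -> bounded_measurable Y ->
  l (fun w => X w + Y w) = l X + l Y.
Hypothesis lZ : forall (c : R) X, bounded_measurable X ->
  l (fun w => c * X w) = c * l X.
Hypothesis l_ge0 : forall X, bounded_measurable X -> (forall w, 0 <= X w) -> 0 <= l X.
Hypothesis l1 : l (cst 1) = 1.
Hypothesis l_cont : forall eta : R, 0 < eta -> exists2 r : R, 0 < r &
  forall D, measurable D -> (P D <= r%:E)%E -> l \1_D <= eta.

Let l_cst c : l (cst c) = c.
Proof.
rewrite -[RHS]mulr1 -l1 -lZ; last exact: bm_cst.
by congr l; apply/funext => w /=; rewrite mulr1.
Qed.

Let l_le X Y : bounded_measurable X -> bounded_measurable Y ->
  (forall w, X w <= Y w) -> l X <= l Y.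
Proof.
move=> bX bY XY; rewrite -subr_ge0 -[- l X]mulN1r -lZ// -lD//; last exact: bmZ.
apply: l_ge0 => [|w]; first by apply: bmD => //; exact: bmZ.
by rewrite mulN1r subr_ge0.
Qed.

Let q (D : set T) : \bar R := (if `[< measurable D >] then l \1_D else 0)%:E.

Let qE D : measurable D -> q D = (l \1_D)%:E.
Proof. by move=> mD; rewrite /q asboolT. Qed.

Let q0 : q set0 = 0%E.
Proof. by rewrite qE// indic0 l_cst. Qed.

Let q_ge0 D : (0 <= q D)%E.
Proof.
rewrite /q lee_fin; case: asboolP => // mD.
by apply: l_ge0 => [|w]; [exact: bm_indic|rewrite indicE].
Qed.

Let l_indic_split (D E : set T) : measurable D -> measurable E ->
  D `&` E = set0 -> l \1_(D `|` E) = l \1_D + l \1_E.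
Proof.
move=> mD mE DE0; rewrite -lD; [|exact: bm_indic|exact: bm_indic].
congr l; apply/funext => w; rewrite !indicE in_setU.
have : w \notin D `&` E by rewrite DE0 in_set0.
by rewrite in_setI; case: (w \in D); case: (w \in E); rewrite ?addr0 ?add0r.
Qed.

Let q_sigma_additive : semi_sigma_additive q.
Proof.
move=> F mF tF mU.
pose D n := \bigcup_(i in [set i | (n <= i)%N]) F i.
have mD n : measurable (D n) by apply: bigcup_measurable => i _; exact: mF.
have DS n : D n = F n `|` D n.+1.
  apply/seteqP; split => w [].
  - move=> i /= ni Fi; have [e|ni'] := eqVneq n i; [by left; rewrite e|right].
    by exists i => //; rewrite /= ltn_neqAle ni' ni.
  - by move=> Fn; exists n => //=.
  - by move=> [i /= ni Fi]; exists i => //; exact: ltnW.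
have FD n : F n `&` D n.+1 = set0.
  rewrite -subset0 => w [Fn [i /= ni Fi]].
  have ein : n = i by apply: (tF n i) => //; exists w.
  by move: ni; rewrite ein ltnn.
have lU n : l \1_(\bigcup_i F i) = \sum_(0 <= i < n) l \1_(F i) + l \1_(D n).
  elim: n => [|n ->].
    by rewrite big_nil add0r; congr (l \1_ _); apply: eq_bigcupl; split.
  by rewrite big_nat_recr//= -addrA [D n]DS l_indic_split.
have PD0 : P (D n) @[n --> \oo] --> 0%E.
  have capD : \bigcap_n D n = set0.
    rewrite -subset0 => w capw; have [i /= _ Fi] := capw 0%N I.
    have [j /= ij Fj] := capw i.+1 I.
    have eij : i = j by apply: (tF i j) => //; exists w.
    by move: ij; rewrite eij ltnn.
  rewrite -(measure0 P) -capD; apply: (@nonincreasing_cvg_mu _ _ _ P) => //.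
  - by rewrite (le_lt_trans (probability_le1 _ _)) ?ltry.
  - by rewrite capD.
  - apply/nonincreasing_seqP => n; apply/subsetPset; rewrite [D n]DS.
    exact: subsetUr.
rewrite qE//.
have -> : (fun n => (\sum_(0 <= i < n) q (F i))%E) =
    (fun n => (l \1_(\bigcup_i F i) - l \1_(D n))%:E).
  apply/funext => n; rewrite (lU n) addrK -sumEFin.
  by apply: eq_bigr => i _; rewrite qE.
apply: cvg_EFin; first exact: nearW.
rewrite -[X in _ --> X]subr0; apply: cvgB; first exact: cvg_cst.
apply/cvgrPdist_le => eta eta0; have [r r0 rl] := l_cont eta0.
have : \forall n \near \oo, (P (D n) <= r%:E)%E.
  have /cvgrPdist_le/(_ r r0) : fine (P (D n)) @[n --> \oo] --> fine (0%E : \bar R).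
    exact: fine_cvg PD0.
  apply: filterS => n; rewrite sub0r normrN => Pr.
  rewrite -[P (D n)]fineK ?fin_num_measure// lee_fin.
  exact: le_trans (ler_norm _) Pr.
apply: filterS => n Pn; rewrite sub0r normrN ger0_norm; first exact: rl.
by apply: l_ge0 => [|w]; [exact: bm_indic|rewrite indicE].
Qed.

Let q1 : q setT = 1%E.
Proof. by rewrite qE// indicT l1. Qed.

(** [X] rounded down to a multiple of [h], at most [K * h], and written as a
    combination of indicators, on which [l] and the integral agree. *)
Let steps (h : R) (K : nat) (X : T -> R) : T -> R :=
  fun w => \sum_(0 <= k < K) h * \1_[set w | k.+1%:R * h <= X w] w.

Let steps_near h K X w : 0 < h -> 0 <= X w <= K%:R * h ->
  steps h K X w <= X w <= steps h K X w + h.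
Proof.
move=> h0 /andP[X0 XK].
suff : [/\ steps h K X w <= X w, (X w < K%:R * h -> X w <= steps h K X w + h) &
    (K%:R * h <= X w -> steps h K X w = K%:R * h)].
  move=> [-> sl sg] /=; have [/sl//|KX] := ltP (X w) (K%:R * h).
  by rewrite sg//; lra.
elim: K {XK} => [|K [IH1 IH2 IH3]].
  by rewrite /steps big_nil mul0r; split => //; lra.
rewrite /steps big_nat_recr//= -/(steps _ _ _ _) indicE.
have -> : (w \in [set w | K.+1%:R * h <= X w]) = (K.+1%:R * h <= X w).
  by apply/idP/idP; rewrite inE.
have KS : K.+1%:R * h = K%:R * h + h by rewrite -natr1 mulrDl mul1r.
case: (leP (K.+1%:R * h) (X w)) => KX.
  rewrite KS in KX *.
  have e : steps h K X w = K%:R * h by apply: IH3; lra.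
  by rewrite e mulr1; split => //; lra.
rewrite mulr0 addr0; split => //.
by move=> _; have [/IH2//|KX'] := ltP (X w) (K%:R * h); rewrite IH3//; lra.
Qed.

(** The measure is [l] on indicators, countably additive by [l_cont]. It
    represents [l] because a positive normalised functional is 1-Lipschitz for
    the uniform norm, in which step functions approximate [X]. *)
Lemma positive_functional_probability : exists Q : probability T R,
  Q `<< P /\ forall X, bounded_measurable X -> \int[Q]_w X w = l X.
Proof.
pose m : measure T R := HB.pack q
  (isMeasure.Build _ _ _ q q0 q_ge0 q_sigma_additive).
pose Q : probability T R := HB.pack (Measure.sort m)
  (Measure_isProbability.Build _ _ _ (Measure.sort m) q1).
exists Q; split.
  apply/null_content_dominatesP => D mD PD0.
  rewrite [LHS](qE mD); congr EFin; apply/eqP; rewrite eq_le; apply/andP; split.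
    apply/ler_addgt0Pr => eta /l_cont[r r0 rl]; rewrite add0r.
    by apply: rl => //; rewrite PD0 lee_fin ltW.
  by apply: l_ge0 => [|w]; [exact: bm_indic|rewrite indicE].
suff Qpos X : bounded_measurable X -> (forall w, 0 <= X w) ->
    \int[Q]_w X w = l X.
  move=> X bX; have [_ [M XM]] := bX.
  have bM : bounded_measurable (cst M : T -> R) by exact: bm_cst.
  have := Qpos (fun w => X w + cst M w) (bmD bX bM).
  rewrite lD// RintD// Rint_cst l_cst => h; apply: (addIr M); apply: h.
  by move=> w; have := XM w; rewrite ler_norml => /andP[h _] /=; lra.
move=> bX X0; have [mX [M XM]] := bX.
have mlev c : measurable [set w | c <= X w].
  rewrite (_ : [set _ | _] = X @^-1` `[c, +oo[).
    by rewrite -[_ @^-1` _]setTI; exact: mX.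
  by apply/seteqP; split => w /=; rewrite in_itv/= andbT.
have bst h K : bounded_measurable (steps h K X).
  elim: K => [|K IH].
    by rewrite (_ : steps _ _ _ = cst 0); [exact: bm_cst|apply/funext => w; rewrite /steps big_nil].
  rewrite (_ : steps _ _ _ = fun w => steps h K X w +
      h * \1_[set w | K.+1%:R * h <= X w] w).
    by apply: bmD => //; apply: bmZ; exact: bm_indic.
  by apply/funext => w; rewrite /steps big_nat_recr.
have Qst h K : \int[Q]_w steps h K X w = l (steps h K X).
  elim: K => [|K IH].
    rewrite (_ : steps _ _ _ = cst 0); first by rewrite Rint_cst l_cst.
    by apply/funext => w; rewrite /steps big_nil.
  rewrite (_ : steps _ _ _ = fun w => steps h K X w +
      h * \1_[set w | K.+1%:R * h <= X w] w); last first.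
    by apply/funext => w; rewrite /steps big_nat_recr.
  have bi : bounded_measurable (\1_[set w | K.+1%:R * h <= X w] : T -> R).
    exact: bm_indic.
  rewrite RintD//; last exact: bmZ.
  rewrite lD//; last exact: bmZ.
  rewrite IH RintZ// lZ// Rint_indic//; congr (_ + h * _).
  exact: (congr1 fine (qE (mlev _))).
have close h : 0 < h -> `|\int[Q]_w X w - l X| <= h.
  move=> h0; pose K := (Num.truncn (M / h)).+1.
  have XK w : 0 <= X w <= K%:R * h.
    rewrite X0 -ler_pdivrMr//; apply: ltW; apply: le_lt_trans (truncnS_gt _).
    by rewrite ler_pM2r ?invr_gt0//; exact: le_trans (ler_norm _) (XM w).
  have st w := steps_near h0 (XK w).
  have bsth : bounded_measurable (fun w => steps h K X w + cst h w).
    by apply: bmD => //; exact: bm_cst.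
  have Q1 : \int[Q]_w steps h K X w <= \int[Q]_w X w.
    by apply: le_Rint => // w; have /andP[] := st w.
  have Q2 : \int[Q]_w X w <= \int[Q]_w steps h K X w + h.
    rewrite -[X in _ + X](Rint_cst Q h) -RintD//; last exact: bm_cst.
    by apply: le_Rint => // w; have /andP[] := st w.
  have L1 : l (steps h K X) <= l X.
    by apply: l_le => // w; have /andP[] := st w.
  have L2 : l X <= l (steps h K X) + h.
    rewrite -[X in _ + X]l_cst -lD//; last exact: bm_cst.
    by apply: l_le => // w; have /andP[] := st w.
  by rewrite Qst in Q1 Q2; rewrite ler_norml; lra.
apply/eqP; rewrite -subr_eq0 -normr_le0; apply/ler_addgt0Pr => h h0.
by rewrite add0r; exact: close.
Qed.

End Representation.

(** * Dual representation of monetary functionals *)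

Section Duality.
Context (R : realType) (disp : measure_display) (T : measurableType disp).
Variable P : probability T R.

(** A bound on the minimal penalty of [Q] in the dual representation of [rho]. *)
Definition penalty_le (rho : (T -> R) -> R) (Q : probability T R) (a : R) :=
  forall X, bounded_measurable X -> \int[Q]_w X w <= rho X + a.

Section SublinearMajorant.
Variables (rho : (T -> R) -> R) (X0 : T -> R) (A : R) (U : set (T -> R)).
Hypotheses (mrho : monetary P rho) (bX0 : bounded_measurable X0).
Hypothesis bU : U `<=` bounded_measurable.
Hypothesis U0 : U (cst 0).
Hypothesis Uconv : forall (l : R) W W', 0 <= l <= 1 -> U W -> U W' ->
  U (fun w => l * W w + (1 - l) * W' w).
Hypothesis AU : forall W, U W -> A <= rho (fun w => X0 w - W w).

(** The sublinear functional [p] is the largest positively homogeneous function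
    below the convex function [h |-> inf over W in U of rho (X0 + h - W) - A]. It
    is finite because [A] bounds [rho] from below on [X0 - U]. A linear form below
    [p] is at most [rho X0 - A] on [U], and taking [W = 0] bounds its penalty. *)
Let V : lmodType R := T -> R^o.
Let f (h W : T -> R) := rho (fun w => X0 w + h w - W w) - A.

Let E (h : T -> R) := [set v | exists s W,
  [/\ 0 < s, U W & v = s * f (fun w => s^-1 * h w) W]].

Let E_add h h' v v' : bounded_measurable h -> bounded_measurable h' ->
  E h v -> E h' v' -> exists2 v'', E (fun w => h w + h' w) v'' & v'' <= v + v'.
Proof.
move=> bh bh' [s [W [s0 UW ->]]] [s' [W' [s'0 UW' ->]]].
have ss0 : 0 < s + s' by exact: addr_gt0.
pose l := s / (s + s').
have l0 : 0 <= l by rewrite divr_ge0// ltW.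
have l1 : l <= 1 by rewrite ler_pdivrMr// mul1r lerDl ltW.
have sl : s = (s + s') * l by rewrite mulrC divfK// gt_eqF.
have sl' : s' = (s + s') * (1 - l) by rewrite mulrBr -sl; ring.
exists ((s + s') * f (fun w => (s + s')^-1 * (h w + h' w))
    (fun w => l * W w + (1 - l) * W' w)).
  exists (s + s'), (fun w => l * W w + (1 - l) * W' w); split => //.
  by apply: Uconv => //; rewrite l0 l1.
rewrite [X in _ <= X * _ + _]sl [X in _ <= _ + X * _]sl'.
rewrite -(mulrA _ l) -(mulrA _ (1 - l)) -mulrDr.
rewrite ler_pM2l// /f.
set Z := (fun w => X0 w + s^-1 * h w - W w).
set Z' := (fun w => X0 w + s'^-1 * h' w - W' w).
have bZ : bounded_measurable Z by apply: bmB; [apply: bmD => //; exact: bmZ|exact: bU].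
have bZ' : bounded_measurable Z' by apply: bmB; [apply: bmD => //; exact: bmZ|exact: bU].
have -> : (fun w => X0 w + (s + s')^-1 * (h w + h' w) - (l * W w + (1 - l) * W' w))
    = (fun w => l * Z w + (1 - l) * Z' w).
  apply/funext => w; rewrite /Z /Z' /l; field.
  by rewrite !gt_eqF.
have [_ _ conv _ _] := mrho.
have := conv Z Z' l bZ bZ'; rewrite l0 l1 => /(_ isT); lra.
Qed.

Let E0_ge0 v : E (cst 0) v -> 0 <= v.
Proof.
move=> [s [W [s0 UW ->]]]; rewrite mulr_ge0 ?(ltW s0)// /f subr_ge0.
rewrite (_ : (fun w => _) = (fun w => X0 w - W w)); first exact: AU.
by apply/funext => w; rewrite mulr0 addr0.
Qed.

Let E_neq0 h : E h !=set0.
Proof.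
by exists (1 * f (fun w => 1^-1 * h w) (cst 0)); exists 1, (cst 0).
Qed.

Let E_lb h : bounded_measurable h -> has_lbound (E h).
Proof.
move=> bh; have [v' Ev'] := E_neq0 (fun w => - h w).
exists (- v') => v Ev; have [v'' Ev''] := E_add bh (bmN bh) Ev Ev'.
have := E0_ge0 (v := v''); rewrite (_ : cst 0 = fun w => h w - h w).
  by move=> /(_ Ev''); lra.
by apply/funext => w; rewrite subrr.
Qed.

Let p (h : T -> R) := inf (E h).

Let p_le h W : bounded_measurable h -> U W ->
  p h <= rho (fun w => X0 w + h w - W w) - A.
Proof.
move=> bh UW; apply: ge_inf; first exact: E_lb.
exists 1, W; split => //; rewrite mul1r /f; congr (rho _ - A).
by apply/funext => w; rewrite invr1 mul1r.
Qed.

Let p_sublinear : sublinear_on (bounded_measurable : set V) p.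
Proof.
split=> [h h' bh bh'|t h].
  apply: inf_le_add => //; first exact/E_lb/bmD.
  by move=> v v'; exact: E_add.
rewrite le_eqVlt => /predU1P[<- bh|t0 bh].
  rewrite mul0r scale0r; apply/ler_addgt0Pr => e e0; rewrite add0r.
  have bc : bounded_measurable (cst 0 : T -> R) by exact: bm_cst.
  pose c := f (cst 0) (cst 0).
  have c0 : 0 <= c.
    apply: E0_ge0; exists 1, (cst 0); split => //; rewrite mul1r /c; congr (f _ _).
    by apply/funext => w; rewrite mulr0.
  pose s := e / (c + 1).
  have c1 : 0 < c + 1 by rewrite ltr_wpDl.
  have s0 : 0 < s by rewrite divr_gt0.
  apply: (@le_trans _ _ (s * c)); last first.
    rewrite /s mulrAC ler_pdivrMr// ler_pM2l// lerDl//.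
  apply: ge_inf; first exact: E_lb bc.
  exists s, (cst 0); split => //; congr (s * f _ _).
  by apply/funext => w; rewrite mulr0.
apply: inf_le_scale => //; [exact/E_lb/bmZ|exact: ltW|].
move=> _ [s [W [s0 UW ->]]]; exists (t * (s * f (fun w => s^-1 * h w) W)) => //.
exists (t * s), W; split => //; first exact: mulr_gt0.
rewrite mulrA; congr (_ * f _ _); apply/funext => w.
rewrite [(t *: h) w](_ : _ = t * h w)//; field.
by rewrite !gt_eqF.
Qed.

Lemma linear_minorant : exists l : (T -> R) -> R,
  [/\ (forall X Y, bounded_measurable X -> bounded_measurable Y ->
         l (fun w => X w + Y w) = l X + l Y),
      (forall (c : R) X, bounded_measurable X -> l (fun w => c * X w) = c * l X) &
      forall h W, bounded_measurable h -> U W ->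
        l h <= rho (fun w => X0 w + h w - W w) - A].
Proof.
have [||l [lD lZ lp]] := @hahn_banach_sublinear R V bounded_measurable _ _ p
  (cst 0) (bm_cst _ _) p_sublinear.
- by move=> x y; exact: bmD.
- by move=> t x; exact: bmZ.
exists l; split => // h W bh UW; apply: le_trans (lp _ bh) _; exact: p_le.
Qed.

End SublinearMajorant.

Lemma exists_lower_bound (delta : nat -> R) N : (forall n, 0 < delta n) ->
  exists2 r, 0 < r & forall n, (n < N)%N -> r <= delta n.
Proof.
move=> d0; elim: N => [|N [r r0 rd]]; first by exists 1.
exists (Num.min r (delta N)); first by rewrite lt_min r0 d0.
move=> n; rewrite ltnS leq_eqVlt => /predU1P[->|/rd rn].
  by rewrite ge_min lexx orbT.
by rewrite ge_min rn.
Qed.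

Lemma excess_indic (c a : R) (D : set T) : measurable D -> 0 <= c -> 0 <= a ->
  excess P (fun w => c * \1_D w) a = Num.max (c - a) 0 * fine (P D).
Proof.
move=> mD c0 a0; rewrite -Rint_indic// -RintZ; last exact: bm_indic.
apply: eq_Rintegral => w _; rewrite indicE; case: (w \in D); rewrite ?mulr1 ?mulr0//.
by rewrite max_r// sub0r oppr_le0.
Qed.

(** A linear form given by [linear_minorant] is positive and normalised because [rho]
    is monotone and translation invariant. It is at most [e] on the admitted
    perturbations, hence small on the indicators of events of small probability,
    and so is an expectation. *)
Lemma monetary_dual rho X0 e : monetary P rho -> bounded_measurable X0 -> 0 < e ->
  exists Q : probability T R,
    Q `<< P /\ penalty_le rho Q (\int[Q]_w X0 w - rho X0 + e).
Proof.
move=> mrho bX0 e0.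
have e20 : 0 < e / 2 by rewrite divr_gt0.
have [delta delta0 Udelta] := monetary_neighbourhood mrho bX0 e20.
pose U := [set W : T -> R | [/\ bounded_measurable W, forall w, 0 <= W w &
  forall n, excess P W (n.+1%:R * (e / 2)) <= delta n]].
pose A := rho X0 - e.
have U0 : U (cst 0).
  split => //; first exact: bm_cst.
  move=> n; rewrite /excess (_ : (fun w => _) = cst 0) ?Rint_cst ?ltW//.
  by apply/funext => w; rewrite max_r// sub0r oppr_le0 mulr_ge0// ltW.
have AU W : U W -> A <= rho (fun w => X0 w - W w).
  by move=> [bW W0 Wx]; apply: le_trans (Udelta _ bW W0 Wx); rewrite /A; lra.
have Uconv (l : R) W W' : 0 <= l <= 1 -> U W -> U W' ->
    U (fun w => l * W w + (1 - l) * W' w).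
  move=> l01 [bW W0 Wx] [bW' W0' Wx']; have /andP[l0 l1] := l01.
  split; first by apply: bmD; exact: bmZ.
    by move=> w; rewrite addr_ge0// mulr_ge0// subr_ge0.
  by move=> n; exact: excess_le_conv.
have bU : U `<=` bounded_measurable by move=> W [].
have [l [lD lZ l_le]] := linear_minorant mrho bX0 bU U0 Uconv AU.
have [mono cash _ _ _] := mrho.
have l_rho h : bounded_measurable h -> l h <= rho (fun w => X0 w + h w) - A.
  move=> bh; have := l_le _ _ bh U0; congr (_ <= rho _ - A).
  by apply/funext => w; rewrite subr0.
have lU W : U W -> l W <= e.
  move=> UW; have := l_le _ _ (bU _ UW) UW.
  rewrite (_ : (fun w => _) = X0); last by apply/funext => w; rewrite addrK.
  by rewrite /A; lra.
(* a linear form bounded above on a half line is nonpositive along it *)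
have ray (a b : R) : (forall t, 0 < t -> t * a <= b) -> a <= 0.
  move=> ab; rewrite leNgt; apply/negP => a0.
  have b1 : 0 < `|b| + 1 by rewrite ltr_wpDl.
  by have := ab _ (divr_gt0 b1 a0); rewrite divfK ?gt_eqF//; have := ler_norm b; lra.
have l_le0 h : bounded_measurable h -> (forall w, h w <= 0) -> l h <= 0.
  move=> bh h0; apply: (ray _ e) => t t0; rewrite -lZ//.
  apply: le_trans (l_rho _ (bmZ t bh)) _.
  have : rho (fun w => X0 w + t * h w) <= rho X0.
    apply: mono => //; first by apply: bmD => //; exact: bmZ.
    by apply: nearW => w; rewrite gerDl pmulr_rle0.
  by rewrite /A; lra.
have l_ge0 h : bounded_measurable h -> (forall w, 0 <= h w) -> 0 <= l h.
  move=> bh h0; rewrite -oppr_le0 -mulN1r -lZ//; apply: l_le0; first exact: bmZ.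
  by move=> w; rewrite mulN1r oppr_le0.
have l1_le t : t * (l (cst 1) - 1) <= e.
  have b1 : bounded_measurable (cst 1 : T -> R) by exact: bm_cst.
  have := l_rho _ (bmZ t b1); rewrite lZ//.
  rewrite (_ : (fun w => _) = (fun w => X0 w + t)).
    by rewrite cash// /A; lra.
  by apply/funext => w; rewrite /= mulr1.
have l1 : l (cst 1) = 1.
  apply/eqP; rewrite -subr_eq0 eq_le; apply/andP; split.
    by apply: (ray _ e) => t _; exact: l1_le.
  by rewrite -oppr_le0; apply: (ray _ e) => t _; have := l1_le (- t); lra.
have l_cont eta : 0 < eta -> exists2 r : R, 0 < r &
    forall D, measurable D -> (P D <= r%:E)%E -> l \1_D <= eta.
  move=> eta0; pose c := e / eta; have c0 : 0 < c by rewrite divr_gt0.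
  (* above the height [c] of [c * \1_D], the excess vanishes *)
  have [r r0 rd] := exists_lower_bound (Num.truncn (c / (e / 2))) delta0.
  exists (r / c); first by rewrite divr_gt0.
  move=> D mD PD; rewrite -(ler_pM2l c0) -lZ; last exact: bm_indic.
  rewrite [c * eta]divfK ?gt_eqF//; apply: lU; split.
  - by apply: bmZ; exact: bm_indic.
  - by move=> w; rewrite mulr_ge0 ?(ltW c0)// indicE.
  - move=> n; have n0 : 0 <= n.+1%:R * (e / 2) by rewrite mulr_ge0// ltW.
    rewrite excess_indic ?(ltW c0)//.
    have [nc|cn] := ltnP n (Num.truncn (c / (e / 2))).
      apply: le_trans (rd _ nc).
      apply: (@le_trans _ _ (c * fine (P D))).
        apply: ler_wpM2r; first exact: fine_ge0.
        by rewrite ge_max (ltW c0) andbT gerBl.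
      rewrite mulrC -ler_pdivlMr// -lee_fin fineK// fin_num_measure//.
    rewrite max_r ?mul0r ?(ltW (delta0 _))// subr_le0 -ler_pdivrMr//.
    by apply: ltW; apply: lt_le_trans (truncnS_gt _) _; rewrite ler_nat.
have [Q [QP QE]] := positive_functional_probability lD lZ l_ge0 l1 l_cont.
exists Q; split => // X bX; rewrite !QE//.
have := l_rho (fun w => X w - X0 w) (bmB bX bX0).
rewrite (_ : (fun w => X0 w + _) = X); last first.
  by apply/funext => w; rewrite addrC subrK.
have -> : l (fun w => X w - X0 w) = l X - l X0.
  rewrite -[- l X0]mulN1r -lZ// -lD//; last exact: bmZ.
  by congr l; apply/funext => w; rewrite mulN1r.
by rewrite /A; lra.
Qed.

End Duality.

(** * Mixtures and exhaustion: an equivalent probability with finite penalty *)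

Section Mixtures.
Context (R : realType) (disp : measure_display) (T : measurableType disp).

Lemma Rint_ext_nonneg (Q : probability T R) (l : (T -> R) -> R) :
  (forall X c, bounded_measurable X -> l (fun w => X w + c) = l X + c) ->
  (forall X, bounded_measurable X -> (forall w, 0 <= X w) -> \int[Q]_w X w = l X) ->
  forall X, bounded_measurable X -> \int[Q]_w X w = l X.
Proof.
move=> lc lpos X bX; have [_ [M XM]] := bX.
have bM : bounded_measurable (cst M : T -> R) by exact: bm_cst.
have := lpos (fun w => X w + M) (bmD bX bM).
rewrite lc// (RintD Q bX bM) Rint_cst => h; apply: (addIr M); apply: h => w.
by have := XM w; rewrite ler_norml => /andP[h _]; lra.
Qed.

Lemma probability_mixture (Q1 Q2 : probability T R) (t : R) : 0 <= t <= 1 ->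
  exists Q : probability T R,
  (forall D, measurable D -> Q D = ((1 - t)%:E * Q1 D + t%:E * Q2 D)%E) /\
  forall X, bounded_measurable X ->
    \int[Q]_w X w = (1 - t) * \int[Q1]_w X w + t * \int[Q2]_w X w.
Proof.
move=> /andP[t0 t1]; have t1' : 0 <= 1 - t by rewrite subr_ge0.
pose m : measure T R :=
  measure_add (mscale (NngNum t1') Q1) (mscale (NngNum t0) Q2).
have mE D : m D = ((1 - t)%:E * Q1 D + t%:E * Q2 D)%E by exact: measure_addE.
have m1 : m setT = 1%E.
  by rewrite mE !probability_setT !mule1 -EFinD subrK.
pose Q : probability T R := HB.pack (Measure.sort m)
  (Measure_isProbability.Build _ _ _ (Measure.sort m) m1).
exists Q; split; first by move=> D _; exact: mE.
apply: Rint_ext_nonneg => [X c bX|X bX X0].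
  have bc : bounded_measurable (cst c : T -> R) by exact: bm_cst.
  by rewrite !(RintD _ bX bc) !Rint_cst; ring.
have mX : measurable_fun setT (EFin \o X) by apply/measurable_EFinP; case: bX.
have X0' w : (0 <= (EFin \o X) w)%E by rewrite lee_fin.
apply: EFin_inj; rewrite EFinD !EFinM !Rint_EFin//.
rewrite [LHS](ge0_integral_measure_add _ _ measurableT (fun w _ => X0' w))//.
congr (_ + _)%E => //.
  exact: (ge0_integral_mscale _ measurableT (NngNum t1') mX).
exact: (ge0_integral_mscale _ measurableT (NngNum t0) mX).
Qed.

Let weight (n : nat) : R := 1 / (2 ^ (n + 1))%:R.

Let weight_ge0 n : 0 <= weight n.
Proof. by rewrite divr_ge0. Qed.

Let weight_sum : (\sum_(0 <= n <oo) (weight n)%:E = 1)%E.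
Proof.
have /cvg_lim -> // := @cvg_geometric_eseries_half R 1 0.
by rewrite expr0 divr1.
Qed.

Lemma probability_mixture_series (Q_ : nat -> probability T R) :
  exists Q : probability T R,
  (forall D, measurable D -> Q D = 0%E <-> forall n, Q_ n D = 0%E) /\
  forall X (a : R), bounded_measurable X ->
    (forall n, \int[Q_ n]_w X w <= a) -> \int[Q]_w X w <= a.
Proof.
pose m_ (n : nat) : measure T R := mscale (NngNum (weight_ge0 n)) (Q_ n).
pose m : measure T R := mseries m_ 0.
have mE D : m D = (\sum_(0 <= n <oo) (weight n)%:E * Q_ n D)%E by [].
have m1 : m setT = 1%E.
  rewrite mE -[RHS]weight_sum; apply: eq_eseriesr => n _.
  by rewrite probability_setT mule1.
pose Q : probability T R := HB.pack (Measure.sort m)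
  (Measure_isProbability.Build _ _ _ (Measure.sort m) m1).
exists Q; split => [D mD|X a bX Xa].
  rewrite [Q D]mE; split => [S0 n|Q0]; last first.
    by apply: eseries0 => n _ _; rewrite Q0 mule0.
  have w0 k : (0 <= (weight k)%:E * Q_ k D)%E by rewrite mule_ge0// lee_fin.
  have : ((weight n)%:E * Q_ n D <= 0)%E.
    rewrite -S0; have := @nneseries_lim_ge R
      (fun k => (weight k)%:E * Q_ k D)%E xpredT 0 n.+1 (fun k _ _ => w0 k).
    apply: le_trans; rewrite big_nat_recr//= leeDr// sume_ge0//.
  rewrite pmule_rle0 ?lte_fin ?divr_gt0// ?ltr0n ?expn_gt0// => Q0.
  by apply/eqP; rewrite eq_le Q0 measure_ge0.
have [_ [M XM]] := bX.
have bM : bounded_measurable (cst M : T -> R) by exact: bm_cst.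
pose Y w := X w + M.
have bY : bounded_measurable Y by exact: bmD.
have Y0 w : 0 <= Y w by have := XM w; rewrite ler_norml => /andP[h _]; rewrite /Y; lra.
have YE (Q' : probability T R) : \int[Q']_w Y w = \int[Q']_w X w + M.
  by rewrite (RintD Q' bX bM) Rint_cst.
rewrite -(lerD2r M) -YE -lee_fin Rint_EFin//.
have mY : measurable_fun setT (EFin \o Y) by apply/measurable_EFinP; case: bY.
have Y0' w : (0 <= (EFin \o Y) w)%E by rewrite lee_fin.
have -> : (\int[Q]_w (Y w)%:E = \sum_(0 <= n <oo) \int[m_ n]_w (Y w)%:E)%E.
  exact: (ge0_integral_measure_series m_ measurableT (fun w _ => Y0' w) mY).
have aM : 0 <= a + M.
  by apply: le_trans (_ : \int[Q_ 0%N]_w Y w <= _); [exact: Rintegral_ge0|rewrite YE lerD2r].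
have -> : ((a + M)%:E = \sum_(0 <= n <oo) (a + M)%:E * (weight n)%:E)%E.
  rewrite nneseriesZl ?weight_sum ?mule1//.
  by move=> n _; rewrite lee_fin.
apply: lee_nneseries => n _; first by move=> _; apply: integral_ge0 => w _; exact: Y0'.
rewrite [leLHS](ge0_integral_mscale _ measurableT (NngNum (weight_ge0 n)) mY)//.
rewrite muleC lee_pmul2r ?lte_fin ?divr_gt0// ?ltr0n ?expn_gt0//.
by rewrite -Rint_EFin// lee_fin YE lerD2r.
Qed.

Section Exhaustion.
Variable P : probability T R.

Lemma exists_maximal_null_set (Q : probability T R) : exists D,
  [/\ measurable D, Q D = 0%E &
      forall E, measurable E -> Q E = 0%E -> (P E <= P D)%E].
Proof.
pose A := [set fine (P D) | D in [set D | measurable D /\ Q D = 0%E]].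
have supA : has_sup A.
  split; first by exists (fine (P set0)), set0.
  exists 1 => _ [D [mD _] <-].
  by rewrite -lee_fin fineK ?fin_num_measure// probability_le1.
have [D_ D_P] : {D_ : nat -> set T & forall k, [/\ measurable (D_ k),
    Q (D_ k) = 0%E & sup A - k.+1%:R^-1 < fine (P (D_ k))]}.
  apply: (@choice _ _ (fun k D => [/\ measurable D, Q D = 0%E &
    sup A - k.+1%:R^-1 < fine (P D)])) => k.
  have [|_ [D [mD QD] <-] Dk] := @sup_adherent _ A (k.+1%:R^-1) _ supA.
    by rewrite invr_gt0.
  by exists D.
have mD_ k : measurable (D_ k) by case: (D_P k).
pose D := \bigcup_k D_ k.
have mD : measurable D by exact: bigcup_measurable.
exists D; split => // [|E mE QE].
  apply/eqP; rewrite eq_le measure_ge0 andbT.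
  apply: (le_trans (measure_sigma_subadditive _ mD_ mD (@subset_refl _ _))).
  by rewrite eseries0// => k _ _; case: (D_P k).
rewrite -[P E]fineK ?fin_num_measure// -[P D]fineK ?fin_num_measure// lee_fin.
apply: (@le_trans _ _ (sup A)).
  by apply: ub_le_sup => //; [case: supA|exists E].
apply/ler_addgt0Pr => e e0; rewrite -lerBlDr.
have [_ _ Dk] := D_P (Num.truncn e^-1).
apply: (@le_trans _ _ (fine (P (D_ (Num.truncn e^-1))))).
  apply: le_trans (ltW Dk); rewrite lerD2l lerN2 -[leRHS]invrK.
  by rewrite lef_pV2 ?posrE ?invr_gt0//; exact/ltW/truncnS_gt.
rewrite fine_le ?fin_num_measure//; apply: le_measure; rewrite ?inE//.
exact: bigcup_sup.
Qed.

(** The Halmos-Savage argument: a member of [C] whose largest null set has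
    nearly the smallest possible [P]-mass must charge everything, since
    otherwise another member of [C] would charge part of that null set. *)
Lemma halmos_savage (C : set (probability T R)) :
  (forall Q, C Q -> Q `<< P) ->
  (forall Q_ : nat -> probability T R, (forall n, C (Q_ n)) -> exists2 Q, C Q &
     forall D, measurable D -> Q D = 0%E -> forall n, Q_ n D = 0%E) ->
  (forall A, measurable A -> (0 < P A)%E -> exists2 Q, C Q & (0 < Q A)%E) ->
  exists2 Q, C Q & P `<< Q.
Proof.
move=> CP Cdom CA.
have [N NP] := choice exists_maximal_null_set.
have [Qt CQt _] : exists2 Q, C Q & (0 < Q setT)%E.
  by apply: CA => //; rewrite probability_setT lte01.
pose A := [set fine (P (N Q)) | Q in C].
have infA : has_inf A.
  split; first by exists (fine (P (N Qt))), Qt.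
  by exists 0 => _ [Q _ <-]; exact: fine_ge0.
have [Q_ Q_P] : {Q_ : nat -> probability T R & forall k, C (Q_ k) /\
    fine (P (N (Q_ k))) < inf A + k.+1%:R^-1}.
  apply: (@choice _ _ (fun k Q => C Q /\
    fine (P (N Q)) < inf A + k.+1%:R^-1)) => k.
  have [|_ [Q CQ <-] Qk] := @inf_adherent _ A (k.+1%:R^-1) _ infA.
    by rewrite invr_gt0.
  by exists Q.
have [Q0 CQ0 Q0dom] := Cdom Q_ (fun k => (Q_P k).1).
have [mD0 QD0 D0max] := NP Q0.
have D0inf : fine (P (N Q0)) <= inf A.
  apply/ler_addgt0Pr => e e0.
  have [_ Qk] := Q_P (Num.truncn e^-1); have [mD _ Dmax] := NP (Q_ (Num.truncn e^-1)).
  have h := Dmax _ mD0 (Q0dom _ mD0 QD0 _).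
  apply: (@le_trans _ _ (fine (P (N (Q_ (Num.truncn e^-1)))))).
    by rewrite fine_le ?fin_num_measure.
  apply: le_trans (ltW Qk) _; rewrite lerD2l -[leRHS]invrK.
  by rewrite lef_pV2 ?posrE ?invr_gt0//; exact/ltW/truncnS_gt.
exists Q0 => //; apply/null_content_dominatesP => D mD QD.
suff PD0 : P (N Q0) = 0%E.
  by apply/eqP; rewrite eq_le measure_ge0 andbT -PD0; exact: D0max.
apply/eqP; rewrite eq_le measure_ge0 andbT leNgt; apply/negP => PD0.
have [Q' CQ' Q'D0] := CA _ mD0 PD0.
have [Q'' CQ'' Q''dom] := Cdom (fun n => if n is 0%N then Q0 else Q')
  (fun n => if n is 0%N as n0 return C (if n0 is 0%N then Q0 else Q')
            then CQ0 else CQ').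
have [mD2 QD2 _] := NP Q''.
have Q0D2 : Q0 (N Q'') = 0%E := Q''dom _ mD2 QD2 0%N.
have Q'D2 : Q' (N Q'') = 0%E := Q''dom _ mD2 QD2 1%N.
have mU := measurableU _ _ mD0 mD2.
have QU : Q0 (N Q0 `|` N Q'') = 0%E.
  apply/eqP; rewrite eq_le measure_ge0 andbT.
  apply: (@le_trans _ _ (Q0 (N Q0) + Q0 (N Q''))%E); first exact: measureU2.
  by rewrite QD0 Q0D2 adde0.
have PU := D0max _ mU QU.
have P02 : (P (N Q0) <= P (N Q''))%E.
  rewrite -[leLHS]fineK ?fin_num_measure// -[leRHS]fineK ?fin_num_measure// lee_fin.
  by apply: le_trans D0inf _; apply: ge_inf; [case: infA|exists Q''].
have mDD : measurable (N Q0 `\` N Q'') by exact: measurableD.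
have PDD : P (N Q0 `\` N Q'') = 0%E.
  apply/eqP; rewrite eq_le measure_ge0 andbT.
  have := le_trans PU P02.
  rewrite (_ : N Q0 `|` N Q'' = (N Q0 `\` N Q'') `|` N Q''); last first.
    apply/seteqP; split => w [wD|wD]; [|by right|by left; case: wD|by right].
    by have [|] := pselect (N Q'' w); [right|left].
  rewrite measureU//; last by rewrite setDKI.
  by rewrite -[X in (_ <= X)%E]add0e leeD2rE// fin_num_measure.
have /null_content_dominatesP Q'P := CP _ CQ'.
move: Q'D0; apply/negP; rewrite -leNgt.
apply: (@le_trans _ _ (Q' ((N Q0 `\` N Q'') `|` N Q''))).
  apply: le_measure; rewrite ?inE//; first exact: measurableU.
  by move=> w Nw; have [|] := pselect (N Q'' w); [right|left].
apply: (@le_trans _ _ (Q' (N Q0 `\` N Q'') + Q' (N Q''))%E); first exact: measureU2.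
by rewrite (Q'P _ mDD PDD) Q'D2 adde0.
Qed.

End Exhaustion.
End Mixtures.

Section EquivalentDuality.
Context (R : realType) (disp : measure_display) (T : measurableType disp).
Variables (P : probability T R) (rho : (T -> R) -> R).
Hypothesis mrho : monetary P rho.

(** What No Free Lunch says of indicator payoffs. *)
Hypothesis charges : forall A, measurable A -> (0 < P A)%E -> 0 < rho \1_A.

(** A nearly optimal [Q] for [\1_A] has [Q A] larger than its penalty, which is
    nonnegative; so it charges [A], and its penalty is at most [1]. The
    probabilities of penalty at most [1] are stable under countable mixtures,
    and exhaustion yields an equivalent one. *)
Lemma exists_equivalent_penalty_le1 : exists Q : probability T R,
  [/\ Q `<< P, P `<< Q & penalty_le rho Q 1].
Proof.
pose C := [set Q : probability T R | Q `<< P /\ penalty_le rho Q 1].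
suff [Q [QP Q1] PQ] : exists2 Q, C Q & P `<< Q by exists Q.
apply: (@halmos_savage _ _ _ P C) => [Q []//|Q_ CQ|A mA PA].
  have [Q [Q0 Qle]] := probability_mixture_series Q_.
  exists Q; last by move=> D mD /(Q0 _ mD).
  split=> [|X bX].
    apply/null_content_dominatesP => D mD PD; apply/(Q0 _ mD) => n.
    by have [/null_content_dominatesP QnP _] := CQ n; exact: QnP.
  by apply: Qle => // n; have [_] := CQ n; exact.
have r0 : 0 < rho \1_A / 2 by rewrite divr_gt0// charges.
have [Q [QP Qpen]] := monetary_dual mrho (bm_indic _ mA) r0.
have QA : \int[Q]_w \1_A w <= 1 :> R.
  by rewrite Rint_indic// -lee_fin fineK ?fin_num_measure// probability_le1.
exists Q; [split => // X bX|].
  by apply: le_trans (Qpen X bX) _; rewrite lerD2l; lra.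
have := Qpen _ (bm_cst _ 0); rewrite Rint_cst (_ : rho (cst 0) = 0); last by case: mrho.
by rewrite Rint_indic// => h; rewrite -[Q A]fineK ?fin_num_measure// lte_fin; lra.
Qed.

(** Mixing a nearly optimal probability with a small part of an equivalent one
    of finite penalty makes it equivalent and keeps it nearly optimal. *)
Lemma monetary_dual_equivalent X0 e : bounded_measurable X0 -> 0 < e ->
  exists (Q : probability T R) (a : R),
  [/\ Q `<< P, P `<< Q, penalty_le rho Q a & rho X0 - e <= \int[Q]_w X0 w - a].
Proof.
move=> bX0 e0; have e20 : 0 < e / 2 by rewrite divr_gt0.
have [Q1 [/null_content_dominatesP Q1P pen1]] := monetary_dual mrho bX0 e20.
have [Q0 [/null_content_dominatesP Q0P /null_content_dominatesP PQ0 pen0]] :=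
  exists_equivalent_penalty_le1.
set a1 := (X in penalty_le rho Q1 X) in pen1.
pose c := rho X0 + 1 - \int[Q0]_w X0 w.
have c0 : 0 <= c by rewrite subr_ge0; exact: pen0.
have ce0 : 0 < c + e by rewrite ltr_wpDl.
pose t := e / 2 / (c + e).
have t0 : 0 < t by rewrite divr_gt0.
have tce : t * (c + e) = e / 2 by rewrite divfK// gt_eqF.
have t1 : t <= 1 by rewrite ler_pdivrMr// mul1r; lra.
have t01 : 0 <= t <= 1 by rewrite t1 ltW.
have [Q [QD QE]] := probability_mixture Q1 Q0 t01.
exists Q, ((1 - t) * a1 + t); split.
- apply/null_content_dominatesP => D mD PD.
  by rewrite [LHS](QD D mD) (Q1P _ mD PD) (Q0P _ mD PD) !mule0 adde0.
- apply/null_content_dominatesP => D mD QD0; apply: PQ0 => //.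
  have : (t%:E * Q0 D <= 0)%E.
    rewrite -QD0 [leRHS](QD D mD) leeDr// mule_ge0// lee_fin; lra.
  rewrite pmule_rle0 ?lte_fin// => h.
  by apply/eqP; rewrite eq_le h measure_ge0.
- move=> X bX; rewrite QE//.
  have t1' : 0 <= 1 - t by rewrite subr_ge0.
  have := ler_wpM2l t1' (pen1 X bX); have := ler_wpM2l (ltW t0) (pen0 X bX); lra.
- rewrite QE//.
  have -> : \int[Q0]_w X0 w = rho X0 + 1 - c by rewrite /c; ring.
  have -> : \int[Q1]_w X0 w = a1 + rho X0 - e / 2 by rewrite /a1; ring.
  have := mulr_ge0 (ltW t0) (ltW e0); lra.
Qed.

End EquivalentDuality.

(** * Spaces of essentially bounded functions *)

Section EssentiallyBounded.
Context (R : realType) (disp : measure_display) (T : measurableType disp).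
Variable P : probability T R.

Lemma Lfun_inftyP (X : T -> R) : X \in Lfun P +oo%E <->
  measurable_fun [set: T] X /\ exists M : R, \forall w \ae P, `|X w| <= M.
Proof.
have P1 : (0 < P setT)%E by rewrite probability_setT lte01.
have normE : ('N[P]_+oo[EFin \o X] = ess_sup P (abse \o (EFin \o X)))%E.
  by rewrite unlock /= P1.
split=> [|[mX [M XM]]].
  rewrite inE => /andP[/[!inE]/= mX]; rewrite /finite_norm normE => fX.
  split => //; have := ess_sup_ge P (abse \o (EFin \o X)).
  move: fX; case: (ess_sup _ _) => [r _|//|_].
    by move=> Xr; exists r; apply: filterS Xr => w; rewrite /= lee_fin.
  by move=> Xr; exists 0; apply: filterS Xr => w; rewrite /= leeNy_eq.
rewrite inE; apply/andP; split; rewrite inE//= /finite_norm normE.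
apply: (@le_lt_trans _ _ M%:E); last exact: ltry.
by apply/ess_supP; apply: filterS XM => w; rewrite /= lee_fin.
Qed.

Lemma measurable_wrtP (G : set_system T) (X : T -> R) : sigma_algebra setT G ->
  measurable_wrt G X <->
  measurable_fun [set: g_sigma_algebraType G] (X : g_sigma_algebraType G -> R).
Proof.
move=> sG; have GE : G.-sigma.-measurable = G := sigma_algebra_id sG.
split=> [GX _ Y mY|mX _ [Y mY <-]].
  by rewrite GE; apply: GX; exists Y.
by rewrite -GE; apply: mX.
Qed.

Section SubSigmaAlgebra.
Variable G : set_system T.
Hypotheses (sG : sigma_algebra setT G) (GT : G `<=` measurable).
Implicit Types X Y : T -> R.

Lemma measurable_wrt_measurable X : measurable_wrt G X -> measurable_fun [set: T] X.
Proof. by move=> GX _ Y mY; apply: GT; apply: GX; exists Y. Qed.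

Lemma LinftyP X : Linfty P G X <->
  measurable_wrt G X /\ exists M : R, \forall w \ae P, `|X w| <= M.
Proof.
split=> [[/Lfun_inftyP[]//]|[GX XM]]; split => //; apply/Lfun_inftyP; split => //.
exact: measurable_wrt_measurable.
Qed.

Lemma Linfty_cst c : Linfty P G (cst c).
Proof.
apply/LinftyP; split; first exact/(measurable_wrtP _ sG).
by exists `|c|; apply: nearW.
Qed.

Lemma LinftyD X Y : Linfty P G X -> Linfty P G Y ->
  Linfty P G (fun w => X w + Y w).
Proof.
move=> /LinftyP[/(measurable_wrtP _ sG) mX [M XM]].
move=> /LinftyP[/(measurable_wrtP _ sG) mY [N YN]].
apply/LinftyP; split; first by apply/(measurable_wrtP _ sG); exact: measurable_funD.
exists (M + N); apply: filterS2 XM YN => w Xw Yw.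
exact: le_trans (ler_normD _ _) (lerD Xw Yw).
Qed.

Lemma LinftyM X Y : Linfty P G X -> Linfty P G Y ->
  Linfty P G (fun w => X w * Y w).
Proof.
move=> /LinftyP[/(measurable_wrtP _ sG) mX [M XM]].
move=> /LinftyP[/(measurable_wrtP _ sG) mY [N YN]].
apply/LinftyP; split; first by apply/(measurable_wrtP _ sG); exact: measurable_funM.
exists (M * N); apply: filterS2 XM YN => w Xw Yw.
by rewrite normrM; exact: ler_pM.
Qed.

Lemma LinftyZ c X : Linfty P G X -> Linfty P G (fun w => c * X w).
Proof. exact/LinftyM/Linfty_cst. Qed.

Lemma LinftyN X : Linfty P G X -> Linfty P G (fun w => - X w).
Proof.
by move=> /(LinftyZ (-1)); congr Linfty; apply/funext => w; rewrite mulN1r.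
Qed.

Lemma LinftyB X Y : Linfty P G X -> Linfty P G Y ->
  Linfty P G (fun w => X w - Y w).
Proof. by move=> LX LY; exact/LinftyD/LinftyN. Qed.

Lemma Linfty_indic A : G A -> Linfty P G \1_A.
Proof.
move=> GA; apply/LinftyP; split.
  apply/(measurable_wrtP _ sG); apply: measurable_indic.
  by have -> : G.-sigma.-measurable = G := sigma_algebra_id sG.
by exists 1; apply: nearW => w; rewrite indicE normr_nat; case: (_ \in _).
Qed.

End SubSigmaAlgebra.

Lemma bm_Linfty X : bounded_measurable X -> Linfty P disp.-measurable X.
Proof.
move=> [mX [M XM]]; apply/LinftyP => //; split; last by exists M; apply: nearW.
by move=> _ [Y mY <-]; exact: mX.
Qed.

Lemma Linfty_measurable X : Linfty P disp.-measurable X -> measurable_fun setT X.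
Proof. by move=> [/Lfun_inftyP[]]. Qed.

Lemma Linfty_bm X : Linfty P disp.-measurable X ->
  exists2 X', bounded_measurable X' & \forall w \ae P, X w = X' w.
Proof.
move=> [/Lfun_inftyP[mX [M XM]] _].
exists (fun w => Num.max (- `|M|) (Num.min (X w) `|M|)).
  split; first by apply: measurable_maxr => //; exact: measurable_minr.
  exists `|M| => w; rewrite ler_norml le_max lexx/= ge_max ge_min lexx orbT andbT.
  by apply: (@le_trans _ _ 0); rewrite ?oppr_le0.
apply: filterS XM => w /le_trans/(_ (ler_norm M)); rewrite ler_norml => /andP[h1 h2].
by rewrite min_l// max_r.
Qed.

End EssentiallyBounded.

(** * Stopped sigma-algebras and the trivial sigma-algebra at time 0 *)

Section AlmostSurely.
Context (R : realType) (disp : measure_display) (T : measurableType disp).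
Implicit Types P Q : probability T R.

Lemma ae_const P (p : Prop) : (\forall w \ae P, p) -> p.
Proof.
have P0 : (0 < P setT)%E by rewrite probability_setT lte01.
have PF := ae_properfilter_algebraOfSetsType P0.
by move=> /filter_ex[].
Qed.

Lemma ae_dominated Q P (p : T -> Prop) : Q `<< P ->
  (\forall w \ae P, p w) -> \forall w \ae Q, p w.
Proof.
move=> /null_content_dominatesP QP [N [mN PN pN]]; exists N; split => //.
exact: QP.
Qed.

Lemma ae_eq_Rint Q X Y : measurable_fun [set: T] X -> measurable_fun [set: T] Y ->
  (\forall w \ae Q, X w = Y w) -> \int[Q]_w X w = \int[Q]_w Y w :> R.
Proof.
move=> mX mY XY; congr fine; apply: ae_eq_integral => //; do ?exact/measurable_EFinP.
by apply: filterS XY => w ->.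
Qed.

End AlmostSurely.

Section Filtrations.
Context (R : realType) (disp : measure_display) (T : measurableType disp).
Variables (F : R -> set_system T).
Hypothesis filtrationF : filtration F.
Implicit Types tau sigma : T -> \bar R.

Let F_alg t : 0 <= t -> sigma_algebra setT (F t).
Proof. by move=> t0; case: (filtrationF.1 t t0). Qed.

Lemma filtrationT t : 0 <= t -> F t setT.
Proof. by move=> /F_alg[F0 FC _]; rewrite -(setD0 setT); exact: FC. Qed.

Lemma filtrationC t A : 0 <= t -> F t A -> F t (~` A).
Proof. by move=> /F_alg[_ FC _] FA; rewrite -setTD; exact: FC. Qed.

Lemma filtrationI t A B : 0 <= t -> F t A -> F t B -> F t (A `&` B).
Proof.
move=> t0 FA FB; rewrite -[A `&` B]setCK setCI; apply: filtrationC => //.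
rewrite -bigcup2E; have [F0 _ FU] := F_alg t0; apply: FU => -[|[|n]] //=;
  exact: filtrationC.
Qed.

Lemma stopping_time0 : stopping_time F time0.
Proof.
split=> // t t0; rewrite (_ : [set _ | _] = setT); first exact: filtrationT.
by apply/seteqP; split => w //= _; rewrite lee_fin.
Qed.

Lemma stopping_time_oo : stopping_time F time_oo.
Proof.
split=> [w|t t0]; first exact: leey.
rewrite (_ : [set _ | _] = set0); first by case: (F_alg t0).
by apply/seteqP; split => w.
Qed.

Lemma stopped_sigma_algebra tau : stopping_time F tau ->
  sigma_algebra setT (stopped_sigma F tau).
Proof.
move=> [_ Ftau]; split.
- by split => // t t0; rewrite set0I; case: (F_alg t0).
- move=> A [mA FA]; split; first by apply: measurableD.
  move=> t t0; rewrite setTD.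
  rewrite (_ : _ `&` _ = [set w | (tau w <= t%:E)%E] `&`
    ~` (A `&` [set w | (tau w <= t%:E)%E])).
    apply: filtrationI => //; first exact: Ftau.
    by apply: filtrationC => //; exact: FA.
  apply/seteqP; split => w /= [h1 h2]; split => //; first by case.
  by move=> Aw; apply: h2.
- move=> A FA; split; first by apply: bigcup_measurable => k _; case: (FA k).
  move=> t t0; rewrite setI_bigcupl; have [_ _ FU] := F_alg t0.
  by apply: FU => k; exact: (FA k).2.
Qed.

Lemma stopped_sigma_measurable tau : stopped_sigma F tau `<=` measurable.
Proof. by move=> A []. Qed.

Lemma stopped_sigma_oo : stopped_sigma F time_oo = measurable.
Proof.
apply/seteqP; split => A; first by case.
move=> mA; split => // t t0; rewrite (_ : [set _ | _] = set0).
  by rewrite setI0; case: (F_alg t0).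
by apply/seteqP; split => w.
Qed.

Lemma stopped_sigma0 : stopped_sigma F time0 `<=` F 0.
Proof.
move=> A [_ /(_ 0 (lexx _))]; rewrite (_ : [set _ | _] = setT) ?setIT//.
by apply/seteqP; split => w //= _.
Qed.

Lemma stopped_sigma_le sigma tau : stopping_time F tau -> le_time sigma tau ->
  stopped_sigma F sigma `<=` stopped_sigma F tau.
Proof.
move=> [_ Ftau] st A [mA FA]; split => // t t0.
rewrite (_ : _ `&` _ = (A `&` [set w | (sigma w <= t%:E)%E]) `&`
    [set w | (tau w <= t%:E)%E]).
  by apply: filtrationI => //; [exact: FA|exact: Ftau].
apply/seteqP; split => w /=; last by move=> [[]].
by move=> [Aw h]; split => //; split => //; exact: le_trans (st w) h.
Qed.

Lemma le_time0 tau : stopping_time F tau -> le_time time0 tau.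
Proof. by move=> [tau0 _] w; exact: tau0. Qed.

Lemma le_time_oo tau : le_time tau time_oo.
Proof. by move=> w; exact: leey. Qed.

Variable P : probability T R.

Lemma LF_le sigma tau X : stopping_time F tau -> le_time sigma tau ->
  LF P F sigma X -> LF P F tau X.
Proof.
by move=> stau st [LX GX]; split => //; apply: subset_trans GX (stopped_sigma_le _ _).
Qed.

Lemma LF_ooE : LF P F time_oo = Linfty P disp.-measurable.
Proof. by rewrite /LF stopped_sigma_oo. Qed.

Hypothesis usualF : usual_conditions P F.

Lemma F0_trivial A : F 0 A -> P A = 0%E \/ P (~` A) = 0%E.
Proof.
have [_ _ ->] := usualF => /(_ [set A | measurable A /\ (P A = 0%E \/ P (~` A) = 0%E)]).
suff : sigma_algebra setT [set A | measurable A /\ (P A = 0%E \/ P (~` A) = 0%E)].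
  by move=> sG h; apply: (h _).2; split => // B [mB PB]; split => //; left.
split.
- by split => //; left; exact: measure0.
- move=> B [mB PB]; rewrite setTD; split; first exact: measurableC.
  by rewrite setCK; case: PB; [right|left].
- move=> B BP; have mB k : measurable (B k) by case: (BP k).
  have mU : measurable (\bigcup_k B k) by exact: bigcup_measurable.
  split => //; have [[k PB]|nB] := pselect (exists k, P (~` B k) = 0%E).
    right; apply: (@subset_measure0 _ _ _ P _ (~` B k)) => //; do ?exact: measurableC.
    by apply: subsetC; exact: bigcup_sup.
  left; apply/negligibleP => //; apply: negligible_bigcup => k; apply/negligibleP => //.
  by have [_ [//|PB]] := BP k; exfalso; apply: nB; exists k.
Qed.

Lemma LF_time0_const X : LF P F time0 X -> exists c, \forall w \ae P, X w = c.
Proof.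
have s0 := stopped_sigma_algebra stopping_time0.
move=> /(LinftyP _ (@stopped_sigma_measurable _))[GX [M XM]].
have mX := measurable_wrt_measurable (@stopped_sigma_measurable _) GX.
pose A := [set q | \forall w \ae P, X w <= q].
have infA : has_inf A.
  split; first by exists M; apply: filterS XM => w; rewrite ler_norml => /andP[].
  exists (- M) => q Aq; apply: (@ae_const _ _ _ P); apply: filterS2 XM Aq => w.
  by rewrite ler_norml => /andP[+ _] => /le_trans; exact.
exists (inf A).
have close n : \forall w \ae P, `|X w - inf A| <= n.+1%:R^-1.
  have n0 : 0 < n.+1%:R^-1 :> R by rewrite invr_gt0.
  have [q Aq qA] := inf_adherent n0 infA.
  have Xlow : \forall w \ae P, inf A - n.+1%:R^-1 <= X w.
    pose D := [set w | X w < inf A - n.+1%:R^-1].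
    have GD : stopped_sigma F time0 D.
      apply: GX; exists (`]-oo, (inf A - n.+1%:R^-1)[%classic); first exact: measurable_itv.
      by rewrite setTI; apply/seteqP; split => w /=; rewrite in_itv.
    have mD : measurable D by case: GD.
    have [PD|PD] := F0_trivial (stopped_sigma0 GD).
      by exists D; split => // w /= /negP; rewrite -ltNge.
    have : A (inf A - n.+1%:R^-1).
      exists (~` D); split => //; first exact: measurableC.
      by move=> w /= h1 h2; apply: h1; exact: ltW.
    by move=> /(ge_inf infA.2); rewrite lerBrDr gerDl leNgt n0.
  apply: filterS2 Xlow Aq => w Xl Xq.
  by rewrite ler_distl Xl /=; exact: le_trans Xq (ltW qA).
apply: filterS (ae_foralln close) => w Xw.
apply/eqP; rewrite -subr_eq0 -normr_le0; apply/ler_addgt0Pr => e e0; rewrite add0r.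
apply: le_trans (Xw (Num.truncn e^-1)) _; rewrite -[leRHS]invrK.
by rewrite lef_pV2 ?posrE ?invr_gt0//; exact/ltW/truncnS_gt.
Qed.

End Filtrations.

(** * The price at time 0 as a monetary functional *)

Section Pricing.
Context (R : realType) (disp : measure_display) (T : measurableType disp).
Variables (P : probability T R) (F : R -> set_system T) (Pi : pricing_family R T).
Hypotheses (filtrationF : filtration F) (usualF : usual_conditions P F).
Hypothesis TCPP_Pi : TCPP P F Pi.
Implicit Types (tau sigma : T -> \bar R) (X Y : T -> R).

Let dppPi : dynamic_pricing_procedure P F Pi. Proof. by case: TCPP_Pi. Qed.

Let st0 := stopping_time0 filtrationF.
Let stoo := stopping_time_oo filtrationF.

Lemma Pi_ae_eq sigma tau X Y : stopping_time F sigma -> stopping_time F tau ->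
  le_time sigma tau -> LF P F tau X -> LF P F tau Y ->
  (\forall w \ae P, X w = Y w) ->
  \forall w \ae P, Pi sigma tau X w = Pi sigma tau Y w.
Proof.
move=> ss st le LX LY XY; have [_ mono _ _ _] := dppPi ss st le.
have XY' : \forall w \ae P, X w <= Y w by apply: filterS XY => w ->.
have YX' : \forall w \ae P, Y w <= X w by apply: filterS XY => w ->.
apply: filterS2 (mono _ _ LX LY XY') (mono _ _ LY LX YX') => w h1 h2.
by apply/eqP; rewrite eq_le h1.
Qed.

(** A payoff known at [tau] is its own price at [tau], by translation invariance;
    time consistency then makes the later maturity irrelevant. *)
Lemma Pi_later_maturity sigma tau upsilon X : stopping_time F sigma ->
  stopping_time F tau -> stopping_time F upsilon ->
  le_time sigma tau -> le_time tau upsilon -> LF P F tau X ->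
  \forall w \ae P, Pi sigma upsilon X w = Pi sigma tau X w.
Proof.
move=> ss st su le le' LX; have LuX := LF_le filtrationF su le' LX.
have [LPi _ trans _ norm0] := dppPi st su le'.
have L0 : LF P F upsilon (cst 0).
  apply: Linfty_cst; first exact: stopped_sigma_algebra su.
  exact: stopped_sigma_measurable.
have PiX : \forall w \ae P, Pi tau upsilon X w = X w.
  have := trans _ _ L0 LX.
  rewrite (_ : cst 0 \+ X = X); last by apply/funext => w; rewrite /= add0r.
  by apply: filterS2 norm0 => w ->; rewrite add0r.
have [_ tc _] := TCPP_Pi.
have h1 := tc _ _ _ ss st su le le' _ LuX.
have h2 := Pi_ae_eq ss st le (LPi _ LuX) LX PiX.
by apply: filterS2 h1 h2 => w <- ->.
Qed.

(** The almost sure value of the price at time [0], a constant because [F 0] is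
    trivial. *)
Definition price X : R := xget 0 [set c | \forall w \ae P, Pi time0 time_oo X w = c].

Lemma price_ae X : LF P F time_oo X ->
  \forall w \ae P, Pi time0 time_oo X w = price X.
Proof.
move=> LX; have [LPi _ _ _ _] := dppPi st0 stoo (@le_time_oo _ _ _ time0).
have [c Xc] := LF_time0_const filtrationF usualF (LPi _ LX).
exact: (xgetPex 0 (ex_intro (fun c => \forall w \ae P, Pi time0 time_oo X w = c) c Xc)).
Qed.

Lemma le_price X Y : LF P F time_oo X -> LF P F time_oo Y ->
  (\forall w \ae P, X w <= Y w) -> price X <= price Y.
Proof.
move=> LX LY XY; have [_ mono _ _ _] := dppPi st0 stoo (@le_time_oo _ _ _ time0).
apply: (@ae_const _ _ _ P).
apply: filterS3 (mono _ _ LX LY XY) (price_ae LX) (price_ae LY) => w.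
by move=> h <- <-.
Qed.

Lemma price_ae_eq X Y : LF P F time_oo X -> LF P F time_oo Y ->
  (\forall w \ae P, X w = Y w) -> price X = price Y.
Proof.
move=> LX LY XY; apply/eqP; rewrite eq_le; apply/andP.
by split; apply: le_price => //; apply: filterS XY => w ->.
Qed.

Lemma price0 : price (cst 0) = 0.
Proof.
have [_ _ _ _ norm0] := dppPi st0 stoo (@le_time_oo _ _ _ time0).
have L0 : LF P F time_oo (cst 0).
  apply: Linfty_cst; first exact: stopped_sigma_algebra stoo.
  exact: stopped_sigma_measurable.
apply: (@ae_const _ _ _ P).
by apply: filterS2 norm0 (price_ae L0) => w -> <-.
Qed.

Lemma price_convex X Y (l : R) : LF P F time_oo X -> LF P F time_oo Y ->
  0 <= l <= 1 ->
  price (fun w => l * X w + (1 - l) * Y w) <= l * price X + (1 - l) * price Y.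
Proof.
move=> LX LY l01; have [_ _ _ conv _] := dppPi st0 stoo (@le_time_oo _ _ _ time0).
have LXY : LF P F time_oo (fun w => l * X w + (1 - l) * Y w).
  have soo := stopped_sigma_algebra filtrationF stoo.
  by apply: LinftyD => //; do ?[exact: stopped_sigma_measurable];
    apply: LinftyZ => //; exact: stopped_sigma_measurable.
have h := conv _ _ _ LX LY l01.
apply: (@ae_const _ _ _ P).
apply: filterS3 h (price_ae LXY) (filterI (price_ae LX) (price_ae LY)) => w.
by move=> + <- [<- <-].
Qed.

Lemma monetary_price : monetary P price.
Proof.
have soo := stopped_sigma_algebra filtrationF stoo.
have LB X : bounded_measurable X -> LF P F time_oo X.
  by rewrite (LF_ooE filtrationF); exact: bm_Linfty.
have [_ _ trans _ _] := dppPi st0 stoo (@le_time_oo _ _ _ time0).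
split.
- by move=> X Y /LB LX /LB LY; exact: le_price.
- move=> X c bX; have LX := LB _ bX.
  have Lc : LF P F time0 (cst c).
    apply: Linfty_cst; first exact: stopped_sigma_algebra st0.
    exact: stopped_sigma_measurable.
  have LXc : LF P F time_oo (X \+ cst c) by apply: LB; apply: bmD => //; exact: bm_cst.
  apply: (@ae_const _ _ _ P).
  apply: filterS3 (trans _ _ LX Lc) (price_ae LX) (price_ae LXc) => w.
  by move=> + <- <-.
- by move=> X Y l /LB LX /LB LY; exact: price_convex.
- exact: price0.
- move=> X_ X bX_ bX Xinc cX.
  have [_ _ cfb] := TCPP_Pi.
  have LX_ n := LB _ (bX_ n); have LX := LB _ bX.
  have h := cfb _ _ st0 stoo (@le_time_oo _ _ _ time0) _ _ LX_ LX Xinc cX.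
  apply: (@ae_const _ _ _ P).
  have hn := ae_foralln (fun n => price_ae (LX_ n)).
  apply: filterS3 h hn (price_ae LX) => w + Xn <-.
  have -> : (fun n => price (X_ n)) = (fun n => Pi time0 time_oo (X_ n) w).
    by apply/funext => n; rewrite Xn.
  exact.
Qed.

(** No Free Lunch forbids a price at most [0] for a nonnegligible event [A], since
    then [\1_A] itself would be a free lunch. *)
Lemma price_indic_gt0 (A : set T) : no_free_lunch P Pi ->
  measurable A -> (0 < P A)%E -> 0 < price \1_A.
Proof.
move=> nfl mA PA; rewrite ltNge; apply/negP => p0.
have LA : LF P F time_oo \1_A.
  by rewrite (LF_ooE filtrationF); apply: bm_Linfty; exact: bm_indic.
pose Z : Loofun P := Lfun_Sub (leey 1%E) LA.1.
have ZE : (Z : T -> R) = \1_A by [].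
have : (closure (free_lunch_cone Pi : set (weakstar P)) `&`
    [set X : weakstar P | \forall w \ae P, 0 <= (X : Loofun P) w]) (Z : weakstar P).
  split; last by apply: nearW => w; rewrite [leRHS](congr1 (@^~ w) ZE) indicE.
  apply: subset_closure; exists 1, Z; split => //; last by rewrite scale1r.
  by apply: filterS (price_ae LA) => w h; rewrite [leLHS]h.
rewrite nfl => -[N [mN PN AN]].
move: PA; rewrite lt_neqAle => /andP[/eqP + _]; apply; apply/esym.
apply: (@subset_measure0 _ _ _ P _ N) => // w Aw; apply: AN => /=.
rewrite [LHS](congr1 (@^~ w) ZE) indicE mem_set//.
by apply/eqP; rewrite oner_eq0.
Qed.

End Pricing.

(** * Probabilities with finite penalty price the market and the options *)

Section FinitePenalty.
Context (R : realType) (disp : measure_display) (T : measurableType disp).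
Variables (P : probability T R) (F : R -> set_system T) (Pi : pricing_family R T).
Hypotheses (filtrationF : filtration F) (usualF : usual_conditions P F).
Hypothesis TCPP_Pi : TCPP P F Pi.
Variables (Q : probability T R) (a : R).
Hypotheses (QP : Q `<< P) (penQ : penalty_le (price P Pi) Q a).
Implicit Types (tau sigma : T -> \bar R) (X Y : T -> R).

Let st0 := stopping_time0 filtrationF.
Let stoo := stopping_time_oo filtrationF.
Let dppPi : dynamic_pricing_procedure P F Pi. Proof. by case: TCPP_Pi. Qed.

Lemma penalty_ge0 : 0 <= a.
Proof.
have := penQ (bm_cst _ 0); rewrite Rint_cst (price0 filtrationF usualF TCPP_Pi).
by rewrite add0r.
Qed.

Lemma Linfty_integrable X : Linfty P disp.-measurable X ->
  Q.-integrable setT (EFin \o X).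
Proof.
move=> LX; have mX := Linfty_measurable LX.
have [X' bX' XX'] := Linfty_bm LX.
have /integrableP[mX' iX'] := bm_integrable Q bX'.
apply/integrableP; split; first exact/measurable_EFinP.
rewrite (ae_eq_integral (fun w => `|(EFin \o X') w|)%E)//.
- by apply: measurableT_comp => //; exact/measurable_EFinP.
- exact: measurableT_comp.
- by apply: filterS (ae_dominated QP XX') => w /= ->.
Qed.

Lemma Linfty_expectation X : Linfty P disp.-measurable X ->
  ('E_Q[X] = (\int[Q]_w X w)%:E)%E.
Proof.
move=> LX; rewrite unlock /Rintegral fineK//.
by apply: integrable_fin_num => //; exact: Linfty_integrable.
Qed.

Lemma penalty_le_Linfty X : LF P F time_oo X -> \int[Q]_w X w <= price P Pi X + a.
Proof.
move=> LX; have LX' := LX; rewrite (LF_ooE filtrationF) in LX'.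
have [X' bX' XX'] := Linfty_bm LX'.
rewrite (ae_eq_Rint _ _ (ae_dominated QP XX')); last first.
- by case: bX'.
- exact: Linfty_measurable LX'.
rewrite (@price_ae_eq _ _ _ _ _ _ filtrationF usualF TCPP_Pi X X')//.
  exact: penQ.
by rewrite (LF_ooE filtrationF); exact: bm_Linfty.
Qed.

Section Martingale.
Variables (sigma tau : T -> \bar R) (X Y : T -> R).
Hypotheses (ss : stopping_time F sigma) (st : stopping_time F tau).
Hypotheses (sle : le_time sigma tau) (LX : LF P F tau X) (LY : LF P F sigma Y).

(** If [n X] is priced [n Y] at [sigma], no position taken at [sigma] on an
    event of [F sigma] has a positive price: on the event its price vanishes,
    and off the event the payoff does. *)
Lemma price_increment_le0 (A : set T) (n : R) : stopped_sigma F sigma A ->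
  (\forall w \ae P, Pi sigma tau (fun v => n * X v) w = n * Y w) ->
  price P Pi (fun w => \1_A w * (n * X w - n * Y w)) <= 0.
Proof.
move=> GA nXY.
have sG := stopped_sigma_algebra filtrationF ss.
have sGt := stopped_sigma_algebra filtrationF st.
have GT := @stopped_sigma_measurable _ _ _ F sigma.
have GTt := @stopped_sigma_measurable _ _ _ F tau.
have [_ mono trans _ norm0] := dppPi ss st sle.
have [mX [M XM]] := (LinftyP _ GTt _).1 LX.
have [mY [N YN]] := (LinftyP _ GT _).1 LY.
have LYt := LF_le filtrationF st sle LY.
have L1A : LF P F sigma \1_A by exact: Linfty_indic.
have L1At := LF_le filtrationF st sle L1A.
have LnX : LF P F tau (fun w => n * X w) by exact: LinftyZ.
have LnY : LF P F tau (fun w => n * Y w) by exact: LinftyZ.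
pose W w := \1_A w * (n * X w - n * Y w).
have LW : LF P F tau W by apply: LinftyM => //; exact: LinftyB.
pose K := `|n| * (M + N).
have WK : \forall w \ae P, `|n * X w - n * Y w| <= K.
  apply: filterS2 XM YN => w Xw Yw; rewrite -mulrBr normrM ler_wpM2l//.
  exact: le_trans (ler_normB _ _) (lerD Xw Yw).
pose Z1 w := - (n * Y w) + K * (1 - \1_A w).
have LZ1 : LF P F sigma Z1.
  apply: LinftyD => //; first by apply: LinftyN => //; exact: LinftyZ.
  by apply: LinftyZ => //; apply: LinftyB => //; exact: Linfty_cst.
have LZ1t := LF_le filtrationF st sle LZ1.
pose Z2 w := K * \1_A w.
have LZ2 : LF P F sigma Z2 by exact: LinftyZ.
have LZ2t := LF_le filtrationF st sle LZ2.
have L0 : LF P F tau (cst 0) by exact: Linfty_cst.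
have ind w : \1_A w = 0 :> R \/ \1_A w = 1 :> R.
  by rewrite indicE; case: (w \in A); [right|left].
have W1 : \forall w \ae P, W w <= ((fun w => n * X w) \+ Z1) w.
  apply: filterS WK => w; rewrite ler_norml => /andP[h1 h2]; rewrite /W /Z1 /=.
  by have [->|->] := ind w; lra.
have W2 : \forall w \ae P, W w <= (cst 0 \+ Z2) w.
  apply: filterS WK => w; rewrite ler_norml => /andP[h1 h2]; rewrite /W /Z2 /=.
  by have [->|->] := ind w; lra.
have LnXZ1 : LF P F tau ((fun w => n * X w) \+ Z1) by exact: LinftyD.
have L0Z2 : LF P F tau (cst 0 \+ Z2) by exact: LinftyD.
have PiW : \forall w \ae P, Pi sigma tau W w <= 0.
  have U1 : \forall w \ae P, Pi sigma tau W w <= n * Y w + Z1 w.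
    apply: filterS3 (mono _ _ LW LnXZ1 W1) (trans _ _ LnX LZ1) nXY => w h e1 e2.
    by rewrite -e2 -e1.
  have U2 : \forall w \ae P, Pi sigma tau W w <= Z2 w.
    apply: filterS3 (mono _ _ LW L0Z2 W2) (trans _ _ L0 LZ2) norm0 => w h e1 e2.
    by rewrite -[Z2 w]add0r -e2 -e1.
  apply: filterS2 U1 U2 => w; rewrite /Z1 /Z2.
  by have [->|->] := ind w; lra.
have le0s := le_time0 ss; have le0t := le_time0 st.
have LWoo := LF_le filtrationF stoo (@le_time_oo _ _ _ tau) LW.
have [LPi _ _ _ _] := dppPi ss st sle.
have [_ mono0 _ _ norm00] := dppPi st0 ss le0s.
have L0s : LF P F sigma (cst 0) by exact: Linfty_cst.
have [_ tc _] := TCPP_Pi.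
have h0 := mono0 _ _ (LPi _ LW) L0s PiW.
have h1 := tc _ _ _ st0 ss st le0s sle _ LW.
have h2 := Pi_later_maturity filtrationF TCPP_Pi st0 st stoo le0t (@le_time_oo _ _ _ tau) LW.
have h3 := price_ae filtrationF usualF TCPP_Pi LWoo.
apply: (@ae_const _ _ _ P).
apply: filterS3 (filterI h0 h1) (filterI h2 h3) norm00 => w [k0 k1] [k2 <-] k3.
by rewrite k2 -k1 -k3.
Qed.

(** The increment has price at most [0] in every quantity, positive or
    negative, so a finite penalty leaves it no expectation. *)
Lemma penalty_martingale :
  (forall n : int, \forall w \ae P,
     Pi sigma tau (fun v => n%:~R * X v) w = n%:~R * Y w) ->
  forall A, stopped_sigma F sigma A -> \int[Q]_w (\1_A w * (X w - Y w)) = 0 :> R.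
Proof.
move=> nXY A GA.
have LYt := LF_le filtrationF st sle LY.
have sGt := stopped_sigma_algebra filtrationF st.
have GTt := @stopped_sigma_measurable _ _ _ F tau.
have L1A : LF P F sigma \1_A.
  by apply: Linfty_indic => //; [exact: stopped_sigma_algebra|exact: stopped_sigma_measurable].
have L1At := LF_le filtrationF st sle L1A.
have LV : LF P F tau (fun w => \1_A w * (X w - Y w)).
  by apply: LinftyM => //; exact: LinftyB.
set I := (X in X = 0).
have nI (n : int) : n%:~R * I <= a.
  have LnV : LF P F tau (fun w => n%:~R * (\1_A w * (X w - Y w))) by exact: LinftyZ.
  have LnVoo := LF_le filtrationF stoo (@le_time_oo _ _ _ tau) LnV.
  have LVoo := LF_le filtrationF stoo (@le_time_oo _ _ _ tau) LV.
  have -> : n%:~R * I = \int[Q]_w (n%:~R * (\1_A w * (X w - Y w))).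
    rewrite RintegralZl//; apply: Linfty_integrable.
    by rewrite -(LF_ooE filtrationF).
  apply: (le_trans (penalty_le_Linfty LnVoo)).
  rewrite gerDr; have := price_increment_le0 GA (nXY n).
  by congr (price _ _ _ <= 0); apply/funext => w; ring.
have bound (k : nat) : `|I| * k%:R <= a.
  have [I0|I0] := leP 0 I; [have := nI k|have := nI (- k%:Z)].
    by rewrite ger0_norm// mulrC.
  by rewrite ltr0_norm// rmorphN/= mulNr mulrC mulNr.
apply/eqP; rewrite -normr_le0 leNgt; apply/negP => I0.
have := bound (Num.truncn (a / `|I|)).+1.
rewrite leNgt => /negP; apply.
by rewrite mulrC -ltr_pdivrMr//; exact: truncnS_gt.
Qed.

End Martingale.

Lemma penalty_local_martingale d (S : 'I_d.+1 -> R -> T -> R) :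
  extends_dynamics P F Pi S -> local_martingale_measure P F S Q.
Proof.
move=> ext; split => // k sigma tau ss st sle [cS LS].
have [LPi _ _ _ _] := dppPi ss st sle.
have sGt := stopped_sigma_algebra filtrationF st.
have GTt := @stopped_sigma_measurable _ _ _ F tau.
have Sn n := ext k n sigma tau ss st sle (conj cS LS).
pose Z := Pi sigma tau (fun v => 1%:~R * at_time (S k) tau v).
have LZ : LF P F sigma Z by apply: LPi; exact: LinftyZ.
have ZS : \forall w \ae P, Z w = at_time (S k) sigma w.
  by apply: filterS (Sn 1) => w; rewrite mul1r.
have LZoo := LF_le filtrationF stoo (@le_time_oo _ _ _ sigma) LZ.
have LSoo := LF_le filtrationF stoo (@le_time_oo _ _ _ tau) LS.
have LZt := LF_le filtrationF st sle LZ.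
rewrite (LF_ooE filtrationF) in LZoo LSoo.
exists Z; split.
- by case: LZ.
- exact: Linfty_integrable.
- move=> A GA.
  have SnZ n : \forall w \ae P,
      Pi sigma tau (fun v => n%:~R * at_time (S k) tau v) w = n%:~R * Z w.
    by apply: filterS2 (Sn n) ZS => w -> ->.
  have mart := penalty_martingale ss st sle LS LZ SnZ GA.
  have mA : measurable A by case: GA.
  have L1A : Linfty P disp.-measurable (\1_A : T -> R).
    by apply: bm_Linfty; exact: bm_indic.
  have sT := @sigma_algebra_measurable _ T.
  have restr X : Linfty P disp.-measurable X ->
      (\int[Q]_(w in A) (X w)%:E = (\int[Q]_w (\1_A w * X w))%:E)%E.
    move=> LX; rewrite integral_mkcond /Rintegral fineK; last first.
      apply: integrable_fin_num => //; apply: Linfty_integrable.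
      exact: LinftyM.
    apply: eq_integral => w _; rewrite patchE indicE.
    by case: ifPn => _; rewrite ?mul1r ?mul0r.
  rewrite !restr//; congr EFin; apply/eqP; rewrite eq_sym -subr_eq0; apply/eqP.
  rewrite -[RHS]mart -RintegralB//; first last.
  + by apply: Linfty_integrable; exact: LinftyM.
  + by apply: Linfty_integrable; exact: LinftyM.
  by apply: eq_Rintegral => w _; rewrite mulrBr.
- exact: ae_dominated QP ZS.
Qed.

(** Quoting the options within their bid-ask spreads bounds the violation of
    these spreads under [Q] by the penalty of [Q]. *)
Lemma beta_le_penalty p (tau : 'I_p -> T -> \bar R) (Y : 'I_p -> T -> R)
    (Cbid Cask : 'I_p -> R) :
  (forall l, stopping_time F (tau l)) -> (forall l, LF P F (tau l) (Y l)) ->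
  (forall l, \forall w \ae P,
     Cbid l <= - Pi time0 (tau l) (\- Y l) w /\ Pi time0 (tau l) (Y l) w <= Cask l) ->
  (beta Y Cbid Cask Q <= a%:E)%E.
Proof.
move=> st LY YC; rewrite /beta; apply: (big_ind (fun x => (x <= a%:E)%E)) => [|x y xa ya|l _].
- by rewrite lee_fin; exact: penalty_ge0.
- by rewrite ge_max xa.
have sG := stopped_sigma_algebra filtrationF (st l).
have GT := @stopped_sigma_measurable _ _ _ F (tau l).
have LNY : LF P F (tau l) (\- Y l) := LinftyN sG GT (LY l).
have LYoo := LF_le filtrationF stoo (@le_time_oo _ _ _ (tau l)) (LY l).
have LNYoo := LF_le filtrationF stoo (@le_time_oo _ _ _ (tau l)) LNY.
have le0 := le_time0 (st l).
have priceE X : LF P F (tau l) X ->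
    \forall w \ae P, Pi time0 (tau l) X w = price P Pi X.
  move=> LX; have LXoo := LF_le filtrationF stoo (@le_time_oo _ _ _ (tau l)) LX.
  apply: filterS2 (Pi_later_maturity filtrationF TCPP_Pi st0 (st l) stoo le0
    (@le_time_oo _ _ _ (tau l)) LX) (price_ae filtrationF usualF TCPP_Pi LXoo) => w.
  by move=> -> .
have [Yb Ya] : Cbid l <= - price P Pi (\- Y l) /\ price P Pi (Y l) <= Cask l.
  apply: (@ae_const _ _ _ P).
  by apply: filterS3 (YC l) (priceE _ (LY l)) (priceE _ LNY) => w h <- <-.
have h1 := penalty_le_Linfty LYoo; have h2 := penalty_le_Linfty LNYoo.
have LYm := LYoo; rewrite (LF_ooE filtrationF) in LYm.
have eN : \int[Q]_w (\- Y l) w = - \int[Q]_w Y l w.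
  rewrite -mulN1r -RintegralZl//; last exact: Linfty_integrable.
  by apply: eq_Rintegral => w _; rewrite mulN1r.
rewrite Linfty_expectation// ge_max -!EFinB !lee_fin; apply/andP.
by move: h2; rewrite eN; split; lra.
Qed.

End FinitePenalty.

(** The price of [X] is nearly [E_Q X] minus the penalty of [Q] for some
    equivalent [Q] of finite penalty. Such a [Q] is a local martingale measure
    and its penalty is at least [beta Q]. *)
Lemma price_le_sup (R : realType) (disp : measure_display)
    (T : measurableType disp) (P : probability T R) (F : R -> set_system T)
    (d : nat) (S : 'I_d.+1 -> R -> T -> R)
    (p : nat) (tau : 'I_p -> T -> \bar R) (Y : 'I_p -> T -> R)
    (Cbid Cask : 'I_p -> R) (Pi : pricing_family R T)
    (filtrationF : filtration F) (usualF : usual_conditions P F)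
    (stopping_tau : forall l, stopping_time F (tau l))
    (LF_Y : forall l, LF P F (tau l) (Y l))
    (TCPP_Pi : TCPP P F Pi) (NFL_Pi : no_free_lunch P Pi)
    (admissible_Pi : strongly_admissible P F Pi S tau Y Cbid Cask)
    (X : T -> R) (LX : Linfty P disp.-measurable X) (e : R) : 0 < e ->
  exists (Q : probability T R) (a : R),
  [/\ equiv_local_martingale_measures P F S Q, (beta Y Cbid Cask Q <= a%:E)%E,
      ('E_Q[X] = (\int[Q]_w X w)%:E)%E & price P Pi X - e <= \int[Q]_w X w - a].
Proof.
move=> e0; have [ext spreads] := admissible_Pi.
have mprice := monetary_price filtrationF usualF TCPP_Pi.
have charges A : measurable A -> (0 < P A)%E -> 0 < price P Pi \1_A.
  exact: (price_indic_gt0 filtrationF usualF TCPP_Pi NFL_Pi).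
have [X' bX' XX'] := Linfty_bm LX.
have [Q [a [QP PQ penQ Qe]]] := monetary_dual_equivalent mprice charges bX' e0.
exists Q, a; split.
- split => //; exact: (penalty_local_martingale filtrationF usualF TCPP_Pi QP penQ).
- apply: (beta_le_penalty filtrationF usualF TCPP_Pi QP penQ stopping_tau LF_Y).
  by move=> l; apply: filterS (spreads l) => w [].
- exact: (Linfty_expectation QP).
- rewrite (ae_eq_Rint _ _ (ae_dominated QP XX')).
  + rewrite (@price_ae_eq _ _ _ _ _ _ filtrationF usualF TCPP_Pi X X')//.
      by rewrite (LF_ooE filtrationF).
    by rewrite (LF_ooE filtrationF); exact: bm_Linfty.
  + exact: Linfty_measurable LX.
  + by case: bX'.
Qed.

Theorem proposition3p7 (R : realType) (disp : measure_display)
    (T : measurableType disp) (P : probability T R) (F : R -> set_system T)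
    (d : nat) (S : 'I_d.+1 -> R -> T -> R)
    (p : nat) (tau : 'I_p -> T -> \bar R) (Y : 'I_p -> T -> R)
    (Cbid Cask : 'I_p -> R) (Pi : pricing_family R T)
    (filtrationF : filtration F) (usualF : usual_conditions P F)
    (marketS : market_model P F S)
    (stopping_tau : forall l, stopping_time F (tau l))
    (LF_Y : forall l, LF P F (tau l) (Y l))
    (TCPP_Pi : TCPP P F Pi) (NFL_Pi : no_free_lunch P Pi)
    (admissible_Pi : strongly_admissible P F Pi S tau Y Cbid Cask)
    (X : T -> R) (LX : Linfty P disp.-measurable X) :
  let Me := equiv_local_martingale_measures P F S in
  let beta := beta Y Cbid Cask in
  \forall w \ae P,
    [/\ (ereal_inf [set 'E_Q[X] + beta Q | Q in Me]
           <= (- Pi time0 time_oo (\- X) w)%:E)%E,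
        - Pi time0 time_oo (\- X) w
          <= Pi time0 time_oo X w &
        ((Pi time0 time_oo X w)%:E
           <= ereal_sup [set 'E_Q[X] - beta Q | Q in Me])%E].
Proof.
move=> Me beta.
have sT := @sigma_algebra_measurable _ T.
have LNX : Linfty P disp.-measurable (\- X) by exact: LinftyN.
have LFX : LF P F time_oo X by rewrite (LF_ooE filtrationF).
have LFNX : LF P F time_oo (\- X) by rewrite (LF_ooE filtrationF).
have price_sup Z := price_le_sup filtrationF usualF stopping_tau LF_Y TCPP_Pi
  NFL_Pi admissible_Pi (X := Z).
apply: filterS2 (price_ae filtrationF usualF TCPP_Pi LFX)
  (price_ae filtrationF usualF TCPP_Pi LFNX) => w -> ->.
split.
- apply/lee_addgt0Pr => e e0.
  have [Q [a [MeQ betaQ EQ Qe]]] := price_sup _ LNX e e0.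
  have [[QP _] _] := MeQ.
  apply: (@le_trans _ _ ('E_Q[X] + beta Q)%E).
    by apply: ereal_inf_lbound; exists Q.
  rewrite (Linfty_expectation QP LX).
  apply: (le_trans (leeD2l _ betaQ)); rewrite -!EFinD lee_fin.
  move: Qe; rewrite (_ : \int[Q]_w0 (\- X) w0 = - \int[Q]_w0 X w0); first lra.
  rewrite -mulN1r -RintegralZl//; last exact: (Linfty_integrable QP).
  by apply: eq_Rintegral => v _; rewrite mulN1r.
- have half : 0 <= (2^-1 : R) <= 1 by rewrite invr_ge0 ler0n invf_le1 ?ler1n.
  have := price_convex filtrationF usualF TCPP_Pi LFX LFNX half.
  rewrite (_ : (fun _ => _) = cst 0); last by apply/funext => v /=; field.
  by rewrite (price0 filtrationF usualF TCPP_Pi); lra.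
- apply/lee_addgt0Pr => e e0.
  have [Q [a [MeQ betaQ EQ Qe]]] := price_sup _ LX e e0.
  have : ('E_Q[X] - beta Q <= ereal_sup [set 'E_Q[X] - beta Q | Q in Me])%E.
    by apply: ereal_sup_ubound; exists Q.
  move=> /(leeD2r e%:E); apply: le_trans; rewrite EQ.
  apply: (@le_trans _ _ ((\int[Q]_w0 X w0)%:E - a%:E + e%:E)%E).
    by rewrite -EFinB -EFinD lee_fin; lra.
  by rewrite leeD2r// leeD2l// leeN2.
Qed.
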